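(* Let $K$ be a field and let $\Lambda = K\mathcal{Q}/I$ be a $(D,A)$-stacked algebra with $D \geqslant 2$ and $A \geqslant 1$. Then the Ext algebra $E(\Lambda) = \bigoplus_{n\geqslant 0}\operatorname{Ext}^n_\Lambda(\Lambda_0,\Lambda_0)$ is generated, as a $K$-algebra, in degrees $0, 1, 2$ and $3$, that is, by $\operatorname{Ext}^0_\Lambda(\Lambda_0,\Lambda_0)$, $\operatorname{Ext}^1_\Lambda(\Lambda_0,\Lambda_0)$, $\operatorname{Ext}^2_\Lambda(\Lambda_0,\Lambda_0)$ and $\operatorname{Ext}^3_\Lambda(\Lambda_0,\Lambda_0)$.
   Context: $\mathcal{Q}$ is a finite quiver, $I$ is an admissible ideal of the path algebra $K\mathcal{Q}$ generated by length homogeneous elements, and $\Lambda = K\mathcal{Q}/I$ is finite-dimensional, with the length grading $\Lambda = \Lambda_0\oplus\Lambda_1\oplus\cdots$. The graded Jacobson radical is $\mathfrak{r} = \Lambda_1\oplus\Lambda_2\oplus\cdots$ and $\Lambda_0\cong\Lambda/\mathfrak{r}$ is a finite product of copies of $K$, viewed as a graded right $\Lambda$-module with minimal graded projective resolution $(P^n,d^n)$. Multiplication in $E(\Lambda)$ is the Yoneda product. Definition: $\Lambda$ is a $(D,A)$-stacked algebra (where $D\geqslant 2$, $A\geqslant 1$ are integers) if, for all $0\leqslant n\leqslant \operatorname{gldim}\Lambda$, the projective $P^n$ in the minimal graded projective resolution of $\Lambda/\mathfrak{r}$ is generated in degree $\delta(n)$, where $\delta(0)=0$, $\delta(1)=1$,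 $\delta(n)=\frac{n}{2}D$ for $n\geqslant 2$ even, and $\delta(n)=\frac{n-1}{2}D+A$ for $n\geqslant 3$ odd. *)

(* Defs.v *)
From HB Require Import structures.
From mathcomp Require Import all_boot all_order all_algebra.
From mathcomp Require Import finmap.
From mathcomp Require Import monalg.
From mathcomp Require Import generic_quotient boolp.

Set Implicit Arguments.
Unset Strict Implicit.
Unset Printing Implicit Defensive.

Import GRing.Theory.
Local Open Scope ring_scope.
Local Open Scope quotient_scope.

(* A K-algebra is a ring with a ring morphism from K to its centre. It may be *)
(* zero, like the path algebra of the empty quiver, which [algType] excludes. *)
HB.mixin Record PzRing_isPzAlgebra (K : fieldType) A of GRing.PzRing A := {
  kscalar : K -> A;
  kscalar1 : kscalar 1 = 1;
  kscalarD : {morph kscalar : k l / k + l};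
  kscalarM : {morph kscalar : k l / k * l};
  kscalarC : forall k a, kscalar k * a = a * kscalar k
}.
#[short(type="pzAlgType")]
HB.structure Definition PzAlgebra (K : fieldType) :=
  {A of GRing.PzRing A & PzRing_isPzAlgebra K A}.

Definition subalgebra (K : fieldType) (A : pzAlgType K) (S : A -> Prop) :=
  [/\ (forall k : K, S (kscalar k)),
      (forall a b, S a -> S b -> S (a + b)) &
      (forall a b, S a -> S b -> S (a * b))].

Definition generates_algebra (K : fieldType) (A : pzAlgType K)
    (G : A -> Prop) :=
  forall S, subalgebra S -> (forall a, G a -> S a) -> forall a, S a.

Section Ideals.
Variable R : pzRingType.
Implicit Types I J G : R -> Prop.

Definition is_ideal I :=
  [/\ I 0, (forall a b, I a -> I b -> I (a + b)) &
      (forall a b c, I b -> I (a * b * c))].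

Definition ideal_gen G : R -> Prop :=
  fun a => forall I, is_ideal I -> (forall g, G g -> I g) -> I a.

Definition ideal_mul I J : R -> Prop :=
  ideal_gen (fun c => exists a b, [/\ I a, J b & c = a * b]).

Definition ideal_exp I n : R -> Prop := iter n (ideal_mul I) (fun=> True).

End Ideals.

Record quiver := Quiver {
  vertex : finType;
  arrow : finType;
  source : arrow -> vertex;
  target : arrow -> vertex
}.

Section Paths.
Variable Q : quiver.

Fixpoint composable (v : vertex Q) (s : seq (arrow Q)) : bool :=
  if s is a :: s' then (source a == v) && composable (target a) s' else true.

Definition endpoint (v : vertex Q) (s : seq (arrow Q)) : vertex Q :=
  last v (map (@target Q) s).

(* A path is its starting vertex and its arrows in the order of traversal;    *)
(* [(v, [::])] is the trivial path at v.                                      *)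
Record qpath := QPath {
  qpval :> vertex Q * seq (arrow Q);
  _ : composable qpval.1 qpval.2
}.
HB.instance Definition _ := [isSub for qpval].
HB.instance Definition _ := [Choice of qpath by <:].

Definition qsource (p : qpath) : vertex Q := p.1.
Definition qtarget (p : qpath) : vertex Q := endpoint p.1 p.2.
Definition qlength (p : qpath) : nat := size p.2.

Definition trivial_path (v : vertex Q) : qpath := @QPath (v, [::]) isT.

Lemma composable_arrow (a : arrow Q) : composable (source a) [:: a].
Proof. by rewrite /= eqxx. Qed.

Definition arrow_path (a : arrow Q) : qpath :=
  @QPath (source a, [:: a]) (composable_arrow a).

Lemma composable_cat v s t :
  composable v (s ++ t) = composable v s && composable (endpoint v s) t.
Proof. by elim: s v => [|a s IHs] v //=; rewrite IHs andbA. Qed.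

Definition qcomp (p q : qpath) : option qpath :=
  if qtarget p == qsource q then insub (p.1, p.2 ++ q.2) else None.

Lemma qcompP p q : qtarget p = qsource q ->
  {r | qcomp p q = Some r & qpval r = (p.1, p.2 ++ q.2)}.
Proof.
move=> pq; have H : composable p.1 (p.2 ++ q.2).
  rewrite composable_cat -[endpoint _ _]/(qtarget p) pq.
  by rewrite (valP p) (valP q).
by exists (QPath (qpval := (_, _)) H); rewrite // /qcomp pq eqxx insubT.
Qed.

Lemma qcomp_None p q : qtarget p != qsource q -> qcomp p q = None.
Proof. by rewrite /qcomp => /negbTE ->. Qed.

Lemma endpoint_cat v s t : endpoint v (s ++ t) = endpoint (endpoint v s) t.
Proof. by rewrite /endpoint map_cat last_cat. Qed.

Lemma qcompA p q r :
  obind (fun x => qcomp x r) (qcomp p q) = obind (qcomp p) (qcomp q r).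
Proof.
case: (eqVneq (qtarget p) (qsource q)) => [pq|npq]; last first.
  rewrite (qcomp_None npq) /=.
  case: (eqVneq (qtarget q) (qsource r)) => [qr|nqr].
    have [x -> xE] /= := qcompP qr; rewrite qcomp_None //.
    by rewrite /qsource xE.
  by rewrite (qcomp_None nqr).
have [x -> xE] /= := qcompP pq.
have tx : qtarget x = qtarget q.
  by rewrite /qtarget xE /= endpoint_cat -[endpoint p.1 _]/(qtarget p) pq.
case: (eqVneq (qtarget q) (qsource r)) => [qr|nqr]; last first.
  by rewrite (qcomp_None nqr) /= qcomp_None // tx.
have [y -> yE] /= := qcompP qr.
have [z -> zE] := qcompP (etrans tx qr).
have py : qtarget p = qsource y by rewrite pq /qsource yE.
have [t -> tE] := qcompP py; congr Some; apply/val_inj.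
by rewrite /= zE tE xE yE /= catA.
Qed.

Lemma qcomp_trivl v p :
  qcomp (trivial_path v) p = if v == qsource p then Some p else None.
Proof.
case: eqVneq => [vp|nvp]; last by rewrite qcomp_None.
have /qcompP [r -> rE] : qtarget (trivial_path v) = qsource p by [].
congr Some; apply/val_inj; rewrite /= rE /= vp.
by rewrite /qsource; case: (qpval p).
Qed.

Lemma qcomp_trivr v p :
  qcomp p (trivial_path v) = if qtarget p == v then Some p else None.
Proof.
case: eqVneq => [vp|nvp]; last by rewrite qcomp_None.
have /qcompP [r -> rE] : qtarget p = qsource (trivial_path v) by [].
congr Some; apply/val_inj; rewrite /= rE /= cats0.
by case: (qpval p).
Qed.

End Paths.

Arguments trivial_path {Q}.
Arguments arrow_path {Q}.

Definition path_algebra (K : fieldType) (Q : quiver) : Type := {malg K[qpath Q]}.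
HB.instance Definition _ K Q := GRing.Lmodule.on (path_algebra K Q).

Definition path_elt (K : fieldType) (Q : quiver) (p : qpath Q) : path_algebra K Q := << p >>.

Definition path_term (K : fieldType) (Q : quiver) (c : K) (r : option (qpath Q)) : path_algebra K Q :=
  if r is Some p then << c *g p >> else 0.

Definition path_one (K : fieldType) (Q : quiver) : path_algebra K Q :=
  \sum_(v : vertex Q) path_elt K (trivial_path v).

HB.lock Definition path_mul (K : fieldType) (Q : quiver)
    (x y : path_algebra K Q) : path_algebra K Q :=
  \sum_(p <- msupp x) \sum_(q <- msupp y) path_term (x@_p * y@_q) (qcomp p q).
Arguments path_mul {K Q} x y.

Section PathAlgebra.
Variables (K : fieldType) (Q : quiver).

Local Notation path_algebra := (path_algebra K Q).
Implicit Types (x y z : path_algebra) (c d e k : K) (p q : qpath Q).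

Lemma path_term0 r : path_term 0 r = 0 :> path_algebra.
Proof. by case: r => //= p; rewrite monalgU0. Qed.

Lemma path_termD c d r : path_term (c + d) r = path_term c r + path_term d r :> path_algebra.
Proof. by case: r => [p|] /=; rewrite ?addr0 ?monalgUD. Qed.

Lemma path_mulw (d1 d2 : {fset qpath Q}) x y :
  (msupp x `<=` d1)%fset -> (msupp y `<=` d2)%fset ->
  path_mul x y =
    \sum_(p <- d1) \sum_(q <- d2) path_term (x@_p * y@_q) (qcomp p q).
Proof.
move=> le1 le2; rewrite path_mul.unlock (big_fset_incl _ le1) /=.
  apply/eq_bigr => p _; apply/big_fset_incl => // q _ /mcoeff_outdom ->.
  by rewrite mulr0 path_term0.
move=> p _ /mcoeff_outdom xp; rewrite big1 // => q _.
by rewrite xp mul0r path_term0.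
Qed.

Lemma path_mulDl : left_distributive (@path_mul K Q) +%R.
Proof.
move=> x y z.
have fr := fsubset_refl (msupp z).
rewrite (path_mulw (msuppD_le x y) fr) (path_mulw (fsubsetUl _ (msupp y)) fr).
rewrite (path_mulw (fsubsetUr (msupp x) _) fr) -big_split /=.
apply/eq_bigr => p _; rewrite -big_split /=; apply/eq_bigr => q _.
by rewrite mcoeffD mulrDl path_termD.
Qed.

Lemma path_mulDr : right_distributive (@path_mul K Q) +%R.
Proof.
move=> z x y.
have fr := fsubset_refl (msupp z).
rewrite (path_mulw fr (msuppD_le x y)) (path_mulw fr (fsubsetUl _ (msupp y))).
rewrite (path_mulw fr (fsubsetUr (msupp x) _)) -big_split /=.
apply/eq_bigr => p _; rewrite -big_split /=; apply/eq_bigr => q _.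
by rewrite mcoeffD mulrDr path_termD.
Qed.

Lemma path_mul0r y : path_mul 0 y = 0.
Proof. by rewrite path_mul.unlock msupp0 big_seq_fset0. Qed.

Lemma path_mulr0 x : path_mul x 0 = 0.
Proof. by rewrite path_mul.unlock; apply/big1 => p _; rewrite msupp0 big_seq_fset0. Qed.

Lemma path_mulUU c d p q :
  path_mul << c *g p >> << d *g q >> = path_term (c * d) (qcomp p q).
Proof.
by rewrite (path_mulw msuppU_le msuppU_le) !big_seq_fset1 !mcoeffUU.
Qed.

Lemma path_mul_suml I (r : seq I) (F : I -> path_algebra) y :
  path_mul (\sum_(i <- r) F i) y = \sum_(i <- r) path_mul (F i) y.
Proof.
exact: (big_morph (path_mul^~ y) (fun a b => path_mulDl a b y) (path_mul0r y)).
Qed.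

Lemma path_mul_sumr I (r : seq I) (F : I -> path_algebra) x :
  path_mul x (\sum_(i <- r) F i) = \sum_(i <- r) path_mul x (F i).
Proof.
exact: (big_morph (path_mul x) (fun a b => path_mulDr x a b) (path_mulr0 x)).
Qed.

Lemma path_mulEl x y :
  path_mul x y = \sum_(p <- msupp x) path_mul << x@_p *g p >> y.
Proof. by rewrite -path_mul_suml -monalgE. Qed.

Lemma path_mulEr x y :
  path_mul x y = \sum_(q <- msupp y) path_mul x << y@_q *g q >>.
Proof. by rewrite -path_mul_sumr -monalgE. Qed.

Lemma path_algebra_ind (P : path_algebra -> Prop) :
  P 0 -> (forall x y, P x -> P y -> P (x + y)) ->
  (forall c p, P << c *g p >>) -> forall x, P x.
Proof. by move=> P0 PD PU x; rewrite [x]monalgE; apply: big_ind. Qed.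

Lemma path_mulUUU c d e p q r :
  path_mul << c *g p >> (path_mul << d *g q >> << e *g r >>) =
  path_mul (path_mul << c *g p >> << d *g q >>) << e *g r >>.
Proof.
have key P S T X Y : path_mul P S = X -> path_mul S T = Y ->
    path_mul P Y = path_mul X T ->
    path_mul P (path_mul S T) = path_mul (path_mul P S) T :> path_algebra.
  by move=> -> ->.
apply: (key _ _ _ _ _ (path_mulUU c d p q) (path_mulUU d e q r)).
transitivity (path_term (c * (d * e)) (obind (qcomp p) (qcomp q r))).
  by case: (qcomp q r) => [s|]; [apply: path_mulUU | apply: path_mulr0].
rewrite -(qcompA p q r) mulrA; case: (qcomp p q) => [t|] /=.
  exact/esym/path_mulUU.
exact/esym/path_mul0r.
Qed.

Lemma path_mulA : associative (@path_mul K Q).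
Proof.
pose assoc x y z := path_mul x (path_mul y z) = path_mul (path_mul x y) z.
have A1 x1 x2 y z : assoc x1 y z -> assoc x2 y z -> assoc (x1 + x2) y z.
  by rewrite /assoc !path_mulDl => -> ->.
have A2 x y1 y2 z : assoc x y1 z -> assoc x y2 z -> assoc x (y1 + y2) z.
  rewrite /assoc (path_mulDl y1) (path_mulDr x (path_mul y1 z)) => -> ->.
  by rewrite (path_mulDr x y1) path_mulDl.
have A3 x y z1 z2 : assoc x y z1 -> assoc x y z2 -> assoc x y (z1 + z2).
  rewrite /assoc (path_mulDr y) (path_mulDr x (path_mul y z1)) => -> ->.
  by rewrite (path_mulDr (path_mul x y)).
have Z1 y z : assoc 0 y z by rewrite /assoc !path_mul0r.
have Z2 x z : assoc x 0 z by rewrite /assoc path_mulr0 !path_mul0r path_mulr0.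
have Z3 x y : assoc x y 0 by rewrite /assoc !path_mulr0.
move=> x y z; rewrite -/(assoc x y z).
elim/path_algebra_ind: x => [|x1 x2|c p]; [exact: Z1 | exact: A1 |].
elim/path_algebra_ind: y => [|y1 y2|d q]; [exact: Z2 | exact: A2 |].
elim/path_algebra_ind: z => [|z1 z2|e r]; [exact: Z3 | exact: A3 |].
exact: path_mulUUU.
Qed.

Lemma path_mul1r : left_id (path_one K Q) (@path_mul K Q).
Proof.
move=> x; rewrite path_mulEr [RHS]monalgE; apply: eq_bigr => p _.
rewrite path_mul_suml (bigD1 (qsource p)) //= big1 => [|v nv].
  by rewrite path_mulUU qcomp_trivl eqxx /= mul1r addr0.
by rewrite path_mulUU qcomp_trivl (negbTE nv).
Qed.

Lemma path_mulr1 : right_id (path_one K Q) (@path_mul K Q).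
Proof.
move=> x; rewrite path_mulEl [RHS]monalgE; apply: eq_bigr => p _.
rewrite path_mul_sumr (bigD1 (qtarget p)) //= big1 => [|v nv].
  by rewrite path_mulUU qcomp_trivr eqxx /= mulr1 addr0.
by rewrite path_mulUU qcomp_trivr eq_sym (negbTE nv).
Qed.

HB.instance Definition _ := GRing.Zmodule_isPzRing.Build path_algebra
  path_mulA path_mul1r path_mulr1 path_mulDl path_mulDr.

Lemma path_termZ k c r : path_term (k * c) r = k *: path_term c r :> path_algebra.
Proof.
case: r => [p|] /=; last by rewrite scaler0.
by apply/malgP => q; rewrite [RHS]mcoeffZ [in LHS]mcoeffU [in RHS]mcoeffU mulrnAr.
Qed.

Lemma path_scalerAl k x y : k *: path_mul x y = path_mul (k *: x) y.
Proof.
rewrite (path_mulw (msuppZ_le k x) (fsubset_refl _)) path_mul.unlock.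
rewrite scaler_sumr; apply: eq_bigr => p _.
rewrite scaler_sumr; apply: eq_bigr => q _.
by rewrite -path_termZ mcoeffZ mulrA.
Qed.

Lemma path_scalerAr k x y : k *: path_mul x y = path_mul x (k *: y).
Proof.
rewrite (path_mulw (fsubset_refl _) (msuppZ_le k y)) path_mul.unlock.
rewrite scaler_sumr; apply: eq_bigr => p _.
rewrite scaler_sumr; apply: eq_bigr => q _.
by rewrite -path_termZ mcoeffZ mulrCA.
Qed.

Definition path_scalar (k : K) : path_algebra := k *: (1 : path_algebra).

Lemma path_scalar1 : path_scalar 1 = 1. Proof. exact: scale1r. Qed.

Lemma path_scalarD : {morph path_scalar : k l / k + l}.
Proof. by move=> k l; apply: scalerDl. Qed.

Lemma path_scalarM : {morph path_scalar : k l / k * l}.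
Proof.
move=> k l; rewrite /path_scalar -[RHS]path_scalerAl -[LHS]scalerA.
by congr (_ *: _); exact/esym/path_mul1r.
Qed.

Lemma path_scalarC k x : path_scalar k * x = x * path_scalar k.
Proof.
transitivity (k *: x).
  by rewrite -[LHS]path_scalerAl; congr (_ *: _); exact: path_mul1r.
by rewrite -[RHS]path_scalerAr; congr (_ *: _); exact/esym/path_mulr1.
Qed.

HB.instance Definition _ := PzRing_isPzAlgebra.Build K path_algebra
  path_scalar1 path_scalarD path_scalarM path_scalarC.

Definition length_homogeneous (n : nat) x :=
  forall p, x@_p != 0 -> qlength p = n.

Definition arrow_ideal : path_algebra -> Prop :=
  ideal_gen (fun x => exists a : arrow Q, x = path_elt K (arrow_path a)).

Definition admissible (I : path_algebra -> Prop) :=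
  [/\ is_ideal I,
      (exists2 N, (2 <= N)%N & forall x, ideal_exp arrow_ideal N x -> I x) &
      (forall x, I x -> ideal_exp arrow_ideal 2 x)].

Definition generated_by_homogeneous (I : path_algebra -> Prop) :=
  exists2 G : path_algebra -> Prop,
    (forall g, G g -> exists n, length_homogeneous n g) &
    (forall x, I x <-> ideal_gen G x).

End PathAlgebra.

(* Right A-modules are left modules over the converse ring: for m in a right  *)
(* module, [a *: m] is the product m.a.                                       *)
Notation rmodType A := (lmodType A^c).

Section Projective.
Variable R : pzRingType.

Definition projective (P : lmodType R) :=
  forall (M N : lmodType R) (g : {linear M -> N}) (f : {linear P -> N}),
    (forall y, exists x, g x = y) ->
    exists h : {linear P -> M}, forall p, g (h p) = f p.

Section Image.
Variables (M N : lmodType R) (g : {linear M -> N}).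

Definition img_pred : {pred N} := fun y => `[< exists x, g x = y >].

Fact img_submod_closed : subsemimod_closed img_pred.
Proof.
split; first split.
- by apply/asboolP; exists 0; rewrite linear0.
- move=> _ _ /asboolP[x <-] /asboolP[y <-]; apply/asboolP.
  by exists (x + y); rewrite linearD.
- move=> a _ /asboolP[x <-]; apply/asboolP.
  by exists (a *: x); rewrite linearZ.
Qed.
HB.instance Definition _ := GRing.isSubmodClosed.Build R N img_pred
  img_submod_closed.

Record img := Img { img_val : N; _ : img_pred img_val }.
HB.instance Definition _ := [isSub for img_val].
HB.instance Definition _ := [Choice of img by <:].
HB.instance Definition _ := [SubChoice_isSubLmodule of img by <:].

End Image.

Definition mk_linear (U V : lmodType R) (f : U -> V) (fL : linear f) :
  {linear U -> V} := HB.pack f (GRing.isLinear.Build R U V *:%R f fL).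

Lemma projective_lift (P M N : lmodType R) (g : {linear M -> N})
    (f : {linear P -> N}) :
  projective P -> (forall p, exists x, g x = f p) ->
  exists h : {linear P -> M}, forall p, g (h p) = f p.
Proof.
move=> projP fg.
have gI x : img_pred g (g x) by apply/asboolP; exists x.
have fI p : img_pred g (f p) by apply/asboolP; exact: fg.
have g'L : linear (fun x => Img (gI x)).
  by move=> a x y; apply: val_inj; rewrite /= linearP.
have f'L : linear (fun p => Img (fI p)).
  by move=> a x y; apply: val_inj; rewrite /= linearP.
have [|h hE] := projP _ _ (mk_linear g'L) (mk_linear f'L).
  by case=> y yI; have /asboolP[x xy] := yI; exists x; apply: val_inj.
by exists h => p; have /(congr1 val) := hE p.
Qed.

(* An augmented complex ... -> P 1 -> P 0 -> M -> 0 of projective modules,    *)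
(* exact everywhere; [res_d n] is the differential d^(n+1).                   *)
Record resolution (M : lmodType R) := Resolution {
  res_mod :> nat -> lmodType R;
  res_d : forall n, {linear res_mod n.+1 -> res_mod n};
  res_aug : {linear res_mod 0 -> M};
  res_projective : forall n, projective (res_mod n);
  res_aug_surj : forall m, exists p, res_aug p = m;
  res_exact0 : forall p, res_aug p = 0 <-> exists q, res_d 0 q = p;
  res_exact : forall n p, res_d n p = 0 <-> exists q, res_d n.+1 q = p
}.

(* gldim <= m and n <= gldim, the latter also when gldim is infinite. *)
Definition gldim_le (m : nat) :=
  forall M : lmodType R, exists P : resolution M,
    forall n, (m < n)%N -> forall p : P n, p = 0.
Definition le_gldim (n : nat) := forall m, gldim_le m -> (n <= m)%N.

End Projective.

Arguments res_d {R M} P n : rename.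
Arguments res_aug {R M} P : rename.

Section Ext.
Variables (K : fieldType) (A : pzAlgType K) (M : rmodType A).
Variable P : resolution M.

Definition kact (V : rmodType A) (k : K) (v : V) : V :=
  ((kscalar k : A) : A^c) *: v.

Lemma kact_linear (U V : rmodType A) k (f : {linear U -> V}) :
  linear (fun u => kact k (f u)).
Proof.
move=> a u v; rewrite /kact linearP scalerDr !scalerA; congr (_ *: _ + _).
exact/esym/(kscalarC k (a : A)).
Qed.

Definition kscale (U V : rmodType A) k (f : {linear U -> V}) :=
  mk_linear (kact_linear k f).

Lemma linear_kact (U V : rmodType A) k (f : {linear U -> V}) u :
  f (kact k u) = kact k (f u).
Proof. exact: linearZ. Qed.

Lemma kact1 (V : rmodType A) (v : V) : kact 1 v = v.
Proof. by rewrite /kact kscalar1 scale1r. Qed.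

Lemma kact0 (V : rmodType A) k : kact k (0 : V) = 0.
Proof. exact: scaler0. Qed.

Lemma kactDl (V : rmodType A) k l (v : V) :
  kact (k + l) v = kact k v + kact l v.
Proof. by rewrite /kact kscalarD; apply: scalerDl. Qed.

Lemma kactDr (V : rmodType A) k (u v : V) :
  kact k (u + v) = kact k u + kact k v.
Proof. exact: scalerDr. Qed.

Lemma kactA (V : rmodType A) k l (v : V) : kact (k * l) v = kact k (kact l v).
Proof. by rewrite /kact scalerA mulrC kscalarM. Qed.

(* A finitely supported family of cocycles x n in Hom_A(P n, M), and the      *)
(* relation of cohomology on them: the direct sum over n of the Ext^n_A(M, M) *)
(* is the quotient.                                                           *)
Record cocycle := Cocycle {
  coc :> forall n, {linear P n -> M};
  coc_d : forall n p, coc n (res_d P n p) = 0;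
  coc_fin : exists N, forall n p, (N <= n)%N -> coc n p = 0
}.

Definition cohom (x y : cocycle) :=
  (forall p, x 0%N p = y 0%N p) /\
  (forall n, exists h : {linear P n -> M},
    forall p, x n.+1 p - y n.+1 p = h (res_d P n p)).

HB.instance Definition _ := gen_eqMixin cocycle.
HB.instance Definition _ := gen_choiceMixin cocycle.

Lemma cohom_refl x : cohom x x.
Proof. by split=> // n; exists \0 => p /=; rewrite subrr. Qed.

Lemma cohom_eq (x y : cocycle) : (forall n p, x n p = y n p) -> cohom x y.
Proof.
by move=> xy; split=> [p|n]; [rewrite xy|exists \0 => p /=; rewrite xy subrr].
Qed.

Lemma cohom_sym x y : cohom x y -> cohom y x.
Proof.
case=> xy0 xy; split=> [p|n]; first by rewrite xy0.
have [h hE] := xy n; exists (\- h) => p /=.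
by rewrite -hE opprB.
Qed.

Lemma cohom_trans y x z : cohom x y -> cohom y z -> cohom x z.
Proof.
case=> xy0 xy [yz0 yz]; split=> [p|n]; first by rewrite xy0.
have [h hE] := xy n; have [g gE] := yz n; exists (h \+ g) => p /=.
by rewrite -hE -gE addrA subrK.
Qed.

Definition cohomb x y := `[< cohom x y >].

Lemma cohomb_equiv : equiv_class_of cohomb.
Proof.
split=> [x|x y|y x z]; first exact/asboolP/cohom_refl.
  by apply/asboolP/asboolP => /cohom_sym.
by move=> /asboolP xy /asboolP yz; apply/asboolP/(cohom_trans xy).
Qed.

Canonical cohom_equiv := EquivRelPack cohomb_equiv.
Canonical cohom_encModRel := defaultEncModRel cohomb.

Definition ext : Type := {eq_quot cohomb}.
HB.instance Definition _ := Choice.on ext.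
HB.instance Definition _ : EqQuotient cocycle cohomb ext := EqQuotient.on ext.

Definition ext_class (x : cocycle) : ext := \pi_ext x.

Fact zero_coc_d n (p : P n.+1) : (\0 : {linear P n -> M}) (res_d P n p) = 0.
Proof. by []. Qed.
Fact zero_coc_fin :
  exists N, forall n (p : P n), (N <= n)%N -> (\0 : {linear P n -> M}) p = 0.
Proof. by exists 0%N. Qed.
Definition zero_coc := Cocycle zero_coc_d zero_coc_fin.

Section CocycleOps.
Variables (x y : cocycle) (k : K).

Fact add_coc_d n p : (x n \+ y n) (res_d P n p) = 0.
Proof. by rewrite /= !coc_d addr0. Qed.
Fact add_coc_fin : exists N, forall n p, (N <= n)%N -> (x n \+ y n) p = 0.
Proof.
have [Nx xN] := coc_fin x; have [Ny yN] := coc_fin y.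
exists (maxn Nx Ny) => n p; rewrite geq_max => /andP[nx ny].
by rewrite /= xN // yN // addr0.
Qed.
Definition add_coc := Cocycle (coc := fun n => x n \+ y n) add_coc_d add_coc_fin.

Fact scale_coc_d n p : kscale k (x n) (res_d P n p) = 0.
Proof. by rewrite /= coc_d kact0. Qed.
Fact scale_coc_fin : exists N, forall n p, (N <= n)%N -> kscale k (x n) p = 0.
Proof.
by have [N xN] := coc_fin x; exists N => n p Nn; rewrite /= xN // kact0.
Qed.
Definition scale_coc :=
  Cocycle (coc := fun n => kscale k (x n)) scale_coc_d scale_coc_fin.

End CocycleOps.

(* [is_lift y l]: the components l i j : P j -> P i form a chain map lifting  *)
(* y along the augmentation; on the degree n part of y this is the usual      *)
(* lifting P (i + n) -> P i, i >= 0, of a cocycle P n -> M.                   *)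
Definition is_lift (y : cocycle) (l : forall i j, {linear P j -> P i}) :=
  [/\ forall j p, res_aug P (l 0%N j p) = y j p,
      forall i j p, res_d P i (l i.+1 j.+1 p) = l i j (res_d P j p),
      forall i j p, (j < i)%N -> l i j p = 0 &
      exists N, forall i j p, (i + N <= j)%N -> l i j p = 0].

Fact dependent_choice (T : nat -> Type) (inv : forall i, T i -> Prop)
    (rel : forall i, T i -> T i.+1 -> Prop) (t0 : T 0%N) :
  inv 0%N t0 ->
  (forall i t, inv i t -> exists t', inv i.+1 t' /\ rel i t t') ->
  exists t : forall i, T i,
    t 0%N = t0 /\ forall i, inv i (t i) /\ rel i (t i) (t i.+1).
Proof.
move=> t0I step; pose S i := {t : T i | inv i t}.
have next i (s : S i) : {s' : S i.+1 | rel i (sval s) (sval s')}.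
  case: s => t tI; have /cid[t' [t'I tt']] := step i t tI.
  by exists (exist _ t' t'I).
pose s := fix s i : S i :=
  if i is i'.+1 then sval (next i' (s i')) else exist _ t0 t0I.
exists (fun i => sval (s i)); split=> // i; split; first exact: svalP (s i).
exact: (svalP (next i (s i))).
Qed.

(* The boundary P i -> P (i - 1), with P (-1) = M. *)
Definition bd_cod i : rmodType A := if i is i'.+1 then P i' else M.
Definition bd i : {linear P i -> bd_cod i} :=
  match i with 0%N => res_aug P | i'.+1 => res_d P i' end.

Lemma bd_d i p : bd i (res_d P i p) = 0.
Proof.
case: i p => [|i] p /=; first by apply/res_exact0; exists p.
by apply/res_exact; exists p.
Qed.

Lemma bd_d0 i p : res_d P i (res_d P i.+1 p) = 0.
Proof. exact: (bd_d p). Qed.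

Lemma bd_exact i p : bd i p = 0 -> exists q, res_d P i q = p.
Proof. by case: i p => [|i] p /=; [move/res_exact0 | move/res_exact]. Qed.

Lemma aug_lift n (f : {linear P n -> M}) :
  exists h : {linear P n -> P 0%N}, forall p, res_aug P (h p) = f p.
Proof.
apply: projective_lift; first exact: res_projective.
by move=> p; apply: res_aug_surj.
Qed.

Lemma d_lift n i (f : {linear P n -> P i}) : (forall p, bd i (f p) = 0) ->
  exists h : {linear P n -> P i.+1}, forall p, res_d P i (h p) = f p.
Proof.
move=> f0; apply: projective_lift; first exact: res_projective.
by move=> p; apply: bd_exact.
Qed.

Lemma lift_exists y : exists l, is_lift y l.
Proof.
have [N yN] := coc_fin y.
pose out i j := (j < i)%N || (i + N <= j)%N.
pose inv i (l : forall j, {linear P j -> P i}) :=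
  (forall j p, bd i (l j (res_d P j p)) = 0) /\
  (forall j p, out i j -> l j p = 0).
pose rel i (l : forall j, {linear P j -> P i})
    (l' : forall j, {linear P j -> P i.+1}) :=
  forall j p, res_d P i (l' j.+1 p) = l j (res_d P j p).
have aug0 j : exists h : {linear P j -> P 0%N},
    (forall p, res_aug P (h p) = y j p) /\ ((N <= j)%N -> forall p, h p = 0).
  case: (leqP N j) => Nj; last by have [h hE] := aug_lift (y j); exists h.
  by exists \0; split=> // p; rewrite linear0 yN.
pose l0 j := sval (cid (aug0 j)).
have l0E j p : res_aug P (l0 j p) = y j p by have [] := svalP (cid (aug0 j)).
have l0N j p : (N <= j)%N -> l0 j p = 0.
  by move=> Nj; have [_] := svalP (cid (aug0 j)); apply.
have [||l [lE lP]] := @dependent_choice _ inv rel l0.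
- by split=> j p /=; [rewrite l0E coc_d | rewrite /out add0n; apply: l0N].
- move=> i l [l1 l2].
  have ex j : exists h : {linear P j.+1 -> P i.+1},
      (forall p, res_d P i (h p) = l j (res_d P j p)) /\
      (out i j -> forall p, h p = 0).
    case oij: (out i j).
      by exists \0; split=> // p; rewrite linear0 l2.
    by have [h hE] := d_lift (f := l j \o res_d P j) (l1 j); exists h.
  pose l' j : {linear P j -> P i.+1} :=
    if j is j'.+1 then sval (cid (ex j')) else \0.
  have l'E : rel i l l' by move=> j p; have [] := svalP (cid (ex j)).
  exists l'; split=> //; split=> [[|j] p|[|j] p o]; rewrite ?linear0 //=.
    by have /= -> := l'E j (res_d P j.+1 p); rewrite bd_d0 linear0.
  by have [_] := svalP (cid (ex j)); apply.
exists l; split=> [j p|i|i j p ji|].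
- by rewrite lE.
- by have [] := lP i.
- by have [[_ ->]] := lP i; rewrite // /out ji.
by exists N => i j p ij; have [[_ ->]] := lP i; rewrite // /out ij orbT.
Qed.

(* A cocycle composed with a lift of another one. *)
Section Compose.
Variables (x y : cocycle) (l : forall i j, {linear P j -> P i}).
Hypothesis yl : is_lift y l.

Definition comp_fun n (p : P n) : M := \sum_(i < n.+1) x i (l i n p).
Fact comp_linear n : linear (@comp_fun n).
Proof.
move=> a p q; rewrite /comp_fun scaler_sumr -big_split /=.
by apply: eq_bigr => i _; rewrite !linearP.
Qed.
Definition comp_lin n := mk_linear (@comp_linear n).

Fact comp_coc_d n p : comp_lin n (res_d P n p) = 0.
Proof.
case: yl => _ lc _ _; rewrite /= /comp_fun big1 // => i _.
by rewrite -lc coc_d.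
Qed.

Fact comp_coc_fin : exists N, forall n p, (N <= n)%N -> comp_lin n p = 0.
Proof.
case: yl => _ _ _ [N lN]; have [Nx xN] := coc_fin x.
exists (Nx + N)%N => n p nN; rewrite /= /comp_fun big1 // => i _.
case: (leqP Nx i) => iN; first by rewrite xN.
by rewrite lN ?linear0 // (leq_trans _ nN) // leq_add2r ltnW.
Qed.

Definition comp_coc := Cocycle comp_coc_d comp_coc_fin.
End Compose.

(* The Yoneda product of [x] and [y] is [x] composed with a lift of [y]. *)
Definition yoneda (x y : cocycle) : cocycle :=
  comp_coc x (proj2_sig (cid (lift_exists y))).

Lemma lift_homotopy y l : is_lift y l -> cohom y zero_coc ->
  exists s : forall i j, {linear P j -> P i},
    (forall p, l 0%N 0%N p = res_d P 0 (s 1%N 0%N p)) /\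
    (forall i j p, l i j.+1 p =
       s i j (res_d P j p) + res_d P i (s i.+1 j.+1 p)).
Proof.
case=> laug lc l0 _ [y0 yh].
have [h hE] : exists h : forall j, {linear P j -> M},
    forall j p, y j.+1 p = h j (res_d P j p).
  exists (fun j => sval (cid (yh j))) => j p.
  by rewrite -(svalP (cid (yh j))) /= subr0.
pose inv i (s : forall j, {linear P j -> P i}) :=
  forall j p, bd i (l i j.+1 p - s j (res_d P j p)) = 0.
pose rel i (s : forall j, {linear P j -> P i})
    (s' : forall j, {linear P j -> P i.+1}) :=
  (forall p, l i 0%N p = res_d P i (s' 0%N p)) /\
  forall j p, l i j.+1 p = s j (res_d P j p) + res_d P i (s' j.+1 p).
pose s0 j := sval (cid (aug_lift (h j))).
have s0E j p : res_aug P (s0 j p) = h j p := svalP (cid (aug_lift (h j))) p.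
have [||s [sE sP]] := @dependent_choice _ inv rel s0.
- by move=> j p /=; rewrite linearB laug s0E hE subrr.
- move=> i s sI.
  have l_0 p : bd i (l i 0%N p) = 0.
    by case: i {s sI} => [|i] /=; [rewrite laug y0 | rewrite l0 ?linear0].
  have [t0 t0E] := d_lift l_0.
  have ex j : exists t : {linear P j.+1 -> P i.+1},
      forall p, res_d P i (t p) = l i j.+1 p - s j (res_d P j p).
    exact: (d_lift (f := l i j.+1 \- (s j \o res_d P j)) (sI j)).
  pose s' j : {linear P j -> P i.+1} :=
    if j is j'.+1 then sval (cid (ex j')) else t0.
  have s'E j p : res_d P i (s' j.+1 p) = l i j.+1 p - s j (res_d P j p).
    exact: svalP (cid (ex j)) p.
  exists s'; split; last first.
    by split=> [p|j p]; rewrite ?t0E // s'E addrC subrK.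
  move=> [|j] p; rewrite -[bd _ _]/(res_d P i _) linearB lc.
    by rewrite t0E subrr.
  rewrite s'E.
  by rewrite opprB addrCA subrr addr0 bd_d0 linear0.
exists s; split=> [p|i j p]; first by have [_ []] := sP 0%N.
by have [_ []] := sP i.
Qed.

Lemma comp_homl x x' y l (yl : is_lift y l) :
  cohom x x' -> cohom (comp_coc x yl) (comp_coc x' yl).
Proof.
case=> xx0 xxh; split=> [p|n]; first by rewrite /= /comp_fun !big_ord1 xx0.
pose h j := sval (cid (xxh j)).
have hE j p : x j.+1 p - x' j.+1 p = h j (res_d P j p) := svalP (cid (xxh j)) p.
have hL : linear (fun p => \sum_(i < n.+1) h i (l i n p)).
  move=> a p q; rewrite scaler_sumr -big_split /=.
  by apply: eq_bigr => i _; rewrite !linearP.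
exists (mk_linear hL) => p; rewrite /= /comp_fun -sumrB big_ord_recl /=.
rewrite xx0 subrr add0r; apply: eq_bigr => i _; case: yl => _ lc _ _.
by rewrite hE lc.
Qed.

Lemma add_lift y y' l l' : is_lift y l -> is_lift y' l' ->
  is_lift (add_coc y y') (fun i j => l i j \+ l' i j).
Proof.
case=> la lc l0 [N lN] [la' lc' l0' [N' lN']]; split=> [j p|i j p|i j p ji|].
- by rewrite /= linearD la la'.
- by rewrite /= linearD lc lc'.
- by rewrite /= l0 // l0' // addr0.
exists (N + N')%N => i j p ij; rewrite /= lN ?lN' ?addr0 //;
  by rewrite (leq_trans _ ij) // leq_add2l ?leq_addr ?leq_addl.
Qed.

Lemma scale_lift k y l : is_lift y l ->
  is_lift (scale_coc y k) (fun i j => kscale k (l i j)).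
Proof.
case=> la lc l0 [N lN]; split=> [j p|i j p|i j p ji|].
- by rewrite /= linear_kact la.
- by rewrite /= linear_kact lc.
- by rewrite /= l0 // kact0.
by exists N => i j p ij; rewrite /= lN // kact0.
Qed.

Lemma kactN1 (V : rmodType A) (v : V) : kact (-1) v = - v.
Proof.
apply: (addIr v); rewrite -{2}[v]kact1 -kactDl !addNr /kact.
suff -> : kscalar 0 = 0 :> A by exact: scale0r.
by apply: (addIr (kscalar 0 : A)); rewrite -kscalarD !add0r.
Qed.

Lemma comp_homr x y y' l l' (yl : is_lift y l) (yl' : is_lift y' l') :
  cohom y y' -> cohom (comp_coc x yl) (comp_coc x yl').
Proof.
move=> yy; have dl := add_lift yl (scale_lift (-1) yl').
have [|s [s0 sE]] := lift_homotopy dl.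
  case: yy => yy0 yyh; split=> [p|n]; first by rewrite /= kactN1 yy0 subrr.
  by have [h hE] := yyh n; exists h => p; rewrite /= kactN1 subr0 hE.
split=> [p|n].
  apply/eqP; rewrite -subr_eq0 /= /comp_fun !big_ord1 -linearB.
  by have := s0 p; rewrite /= kactN1 => ->; rewrite coc_d.
have hL : linear (fun p => \sum_(i < n.+2) x i (s i n p)).
  move=> a p q; rewrite scaler_sumr -big_split /=.
  by apply: eq_bigr => i _; rewrite !linearP.
exists (mk_linear hL) => p; rewrite /= /comp_fun -sumrB.
apply: eq_bigr => i _; rewrite -linearB.
have /= := sE i n p; rewrite kactN1 => ->.
by rewrite linearD coc_d addr0.
Qed.

Lemma yoneda_comp x y l (yl : is_lift y l) :
  cohom (yoneda x y) (comp_coc x yl).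
Proof. exact/comp_homr/cohom_refl. Qed.

Lemma yoneda_cohom x x' y y' :
  cohom x x' -> cohom y y' -> cohom (yoneda x y) (yoneda x' y').
Proof.
move=> xx yy; apply: cohom_trans (comp_homl _ xx) _.
exact: comp_homr.
Qed.

Lemma add_cohom x x' y y' :
  cohom x x' -> cohom y y' -> cohom (add_coc x y) (add_coc x' y').
Proof.
case=> x0 xh [y0 yh]; split=> [p|n]; first by rewrite /= x0 y0.
have [h hE] := xh n; have [g gE] := yh n; exists (h \+ g) => p /=.
by rewrite -hE -gE opprD addrACA.
Qed.

Lemma scale_cohom k x x' : cohom x x' -> cohom (scale_coc x k) (scale_coc x' k).
Proof.
case=> x0 xh; split=> [p|n]; first by rewrite /= x0.
have [h hE] := xh n; exists (kscale k h) => p /=.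
by rewrite -hE kactDr -!kactN1 -!kactA mulrC.
Qed.

(* The identity of M, as a cocycle of degree 0. *)
Definition one_fun n : {linear P n -> M} :=
  if n is 0%N then res_aug P else \0.
Fact one_coc_d n p : one_fun n (res_d P n p) = 0.
Proof. by case: n p => [|n] p //=; apply: (@bd_d 0%N). Qed.
Fact one_coc_fin : exists N, forall n p, (N <= n)%N -> one_fun n p = 0.
Proof. by exists 1%N => -[]. Qed.
Definition one_coc := Cocycle one_coc_d one_coc_fin.

Definition id_lift i j : {linear P j -> P i} :=
  if @eqP _ j i is ReflectT e
  then ecast i {linear P j -> P i} e (idfun : {linear P j -> P j}) else \0.

Lemma id_lift_id i p : id_lift i i p = p.
Proof. by rewrite /id_lift; case: eqP => // e; rewrite eq_axiomK. Qed.

Lemma id_lift_0 i j p : j != i -> id_lift i j p = 0.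
Proof. by rewrite /id_lift; case: eqP. Qed.

Lemma one_lift : is_lift one_coc id_lift.
Proof.
split=> [[|j] p|i j p|i j p ji|].
- by rewrite id_lift_id.
- by rewrite id_lift_0 // linear0.
- case: (eqVneq j i) p => [->|ji] p; first by rewrite !id_lift_id.
  by rewrite !id_lift_0 ?linear0 // eqSS.
- by rewrite id_lift_0 // ltn_eqF.
exists 1%N => i j p ij; rewrite id_lift_0 // eq_sym ltn_eqF //.
by rewrite addn1 in ij.
Qed.

Section CompLift.
Variables (y z : cocycle) (l m : forall i j, {linear P j -> P i}).
Hypotheses (yl : is_lift y l) (zm : is_lift z m).

Fact comp_lift_linear i k : linear (fun p => \sum_(j < k.+1) l i j (m j k p)).
Proof.
move=> a p q; rewrite scaler_sumr -big_split /=.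
by apply: eq_bigr => j _; rewrite !linearP.
Qed.
Definition comp_lift i k := mk_linear (@comp_lift_linear i k).

Lemma comp_liftP : is_lift (comp_coc y zm) comp_lift.
Proof.
case: (yl) (zm) => la lc l0 [N lN] [ma mc m0 [N' mN]].
split=> [k p|i k p|i k p ki|].
- by rewrite /= /comp_fun linear_sum; apply: eq_bigr => j _; rewrite la.
- rewrite /= big_ord_recl l0 // add0r linear_sum /=.
  by apply: eq_bigr => j _; rewrite lc mc.
- by rewrite /= big1 // => j _; rewrite l0 // (leq_trans _ ki).
exists (N + N')%N => i k p ik; rewrite /= big1 // => j _.
case: (leqP (i + N) j) => ij; first by rewrite lN.
by rewrite mN ?linear0 // (leq_trans _ ik) // addnA leq_add2r ltnW.
Qed.

End CompLift.

Lemma yonedaA x y z : cohom (yoneda x (yoneda y z)) (yoneda (yoneda x y) z).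
Proof.
rewrite /yoneda; case: (cid (lift_exists z)) => m zm /=.
case: (cid (lift_exists y)) => l yl /=.
apply: cohom_trans (yoneda_comp x (comp_liftP yl zm)) _.
apply: cohom_eq => k p; rewrite /= /comp_fun /=.
under eq_bigr => i _ do rewrite linear_sum.
rewrite exchange_big /=; apply: eq_bigr => j _.
rewrite /comp_fun (@big_ord_widen _ _ _ j.+1 k.+1 (fun i => x i (l i j (m j k p)))) //.
rewrite [RHS]big_mkcond /=; apply: eq_bigr => i _.
by case: ltnP => // ij; case: yl => _ _ l0 _; rewrite l0 ?linear0.
Qed.

Lemma yoneda1 x : cohom (yoneda x one_coc) x.
Proof.
apply: cohom_trans (yoneda_comp x one_lift) (cohom_eq _) => n p.
rewrite /= /comp_fun big_ord_recr /= id_lift_id big1 ?add0r // => i _.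
by rewrite id_lift_0 ?linear0 // eq_sym ltn_eqF.
Qed.

Lemma one_yoneda x : cohom (yoneda one_coc x) x.
Proof.
apply: cohom_eq => n p; rewrite /yoneda; case: (cid _) => l xl /=.
rewrite /comp_fun big_ord_recl /= big1 ?addr0 //.
by case: xl => la _ _ _; rewrite la.
Qed.

Lemma yonedaDl x x' y :
  cohom (yoneda (add_coc x x') y) (add_coc (yoneda x y) (yoneda x' y)).
Proof.
by apply: cohom_eq => n p; rewrite /= /comp_fun -big_split.
Qed.

Lemma yonedaDr x y y' :
  cohom (yoneda x (add_coc y y')) (add_coc (yoneda x y) (yoneda x y')).
Proof.
rewrite /yoneda; case: (cid (lift_exists y)) (cid (lift_exists y')) =>
  l yl [l' yl'] /=.
apply: cohom_trans (yoneda_comp x (add_lift yl yl')) (cohom_eq _) => n p.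
rewrite /= /comp_fun -big_split; apply: eq_bigr => i _ /=.
by rewrite linearD.
Qed.

Lemma yonedaZl k x y :
  cohom (yoneda (scale_coc x k) y) (scale_coc (yoneda x y) k).
Proof.
by apply: cohom_eq => n p; rewrite /= /comp_fun /kact scaler_sumr.
Qed.

Lemma yonedaZr k x y :
  cohom (yoneda x (scale_coc y k)) (scale_coc (yoneda x y) k).
Proof.
rewrite /yoneda; case: (cid (lift_exists y)) => l yl /=.
apply: cohom_trans (yoneda_comp x (scale_lift k yl)) (cohom_eq _) => n p.
rewrite /= /comp_fun [RHS]/kact scaler_sumr; apply: eq_bigr => i _ /=.
by rewrite linear_kact.
Qed.

Definition ext_zero : ext := ext_class zero_coc.
Definition ext_opp (a : ext) : ext := ext_class (scale_coc (repr a) (-1)).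
Definition ext_add (a b : ext) : ext := ext_class (add_coc (repr a) (repr b)).
Definition ext_one : ext := ext_class one_coc.
Definition ext_mul (a b : ext) : ext := ext_class (yoneda (repr a) (repr b)).
Definition ext_scalar (k : K) : ext := ext_class (scale_coc one_coc k).

Lemma ext_classP x y : ext_class x = ext_class y <-> cohom x y.
Proof.
split=> [/eqmodP/asboolP //|xy].
by apply/eqmodP/asboolP.
Qed.

Lemma ext_ind (Q : ext -> Prop) : (forall x, Q (ext_class x)) -> forall a, Q a.
Proof. by move=> H; apply: quotW. Qed.

Lemma cohom_repr x : cohom (repr (ext_class x)) x.
Proof. by apply/ext_classP; rewrite /ext_class reprK. Qed.

Lemma ext_addE x y :
  ext_add (ext_class x) (ext_class y) = ext_class (add_coc x y).
Proof. exact/ext_classP/add_cohom/cohom_repr/cohom_repr. Qed.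

Lemma ext_oppE x : ext_opp (ext_class x) = ext_class (scale_coc x (-1)).
Proof. exact/ext_classP/scale_cohom/cohom_repr. Qed.

Lemma ext_mulE x y :
  ext_mul (ext_class x) (ext_class y) = ext_class (yoneda x y).
Proof. exact/ext_classP/yoneda_cohom/cohom_repr/cohom_repr. Qed.

Fact ext_addA : associative ext_add.
Proof.
elim/ext_ind=> x; elim/ext_ind=> y; elim/ext_ind=> z; rewrite !ext_addE.
by apply/ext_classP/cohom_eq => n p; rewrite /= addrA.
Qed.

Fact ext_addC : commutative ext_add.
Proof.
elim/ext_ind=> x; elim/ext_ind=> y; rewrite !ext_addE.
by apply/ext_classP/cohom_eq => n p; rewrite /= addrC.
Qed.

Fact ext_add0 : left_id ext_zero ext_add.
Proof.
elim/ext_ind=> x; rewrite ext_addE.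
by apply/ext_classP/cohom_eq => n p; rewrite /= add0r.
Qed.

Fact ext_addN : left_inverse ext_zero ext_opp ext_add.
Proof.
elim/ext_ind=> x; rewrite ext_oppE ext_addE.
by apply/ext_classP/cohom_eq => n p; rewrite /= kactN1 addNr.
Qed.

HB.instance Definition _ := GRing.isZmodule.Build ext
  ext_addA ext_addC ext_add0 ext_addN.

Fact ext_mulA : associative ext_mul.
Proof.
elim/ext_ind=> x; elim/ext_ind=> y; elim/ext_ind=> z; rewrite !ext_mulE.
exact/ext_classP/yonedaA.
Qed.

Fact ext_mul1r : left_id ext_one ext_mul.
Proof. by elim/ext_ind=> x; rewrite ext_mulE; apply/ext_classP/one_yoneda. Qed.

Fact ext_mulr1 : right_id ext_one ext_mul.
Proof. by elim/ext_ind=> x; rewrite ext_mulE; apply/ext_classP/yoneda1. Qed.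

Fact ext_mulDl : left_distributive ext_mul ext_add.
Proof.
elim/ext_ind=> x; elim/ext_ind=> y; elim/ext_ind=> z.
rewrite !(ext_addE, ext_mulE); exact/ext_classP/yonedaDl.
Qed.

Fact ext_mulDr : right_distributive ext_mul ext_add.
Proof.
elim/ext_ind=> x; elim/ext_ind=> y; elim/ext_ind=> z.
rewrite !(ext_addE, ext_mulE); exact/ext_classP/yonedaDr.
Qed.

HB.instance Definition _ := GRing.Zmodule_isPzRing.Build ext
  ext_mulA ext_mul1r ext_mulr1 ext_mulDl ext_mulDr.

Fact ext_scalar1 : ext_scalar 1 = 1.
Proof. by apply/ext_classP/cohom_eq => n p; rewrite /= kact1. Qed.

Fact ext_scalarD : {morph ext_scalar : k l / k + l}.
Proof.
move=> k l; rewrite -[RHS]/(ext_add _ _) ext_addE.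
by apply/ext_classP/cohom_eq => n p; rewrite /= kactDl.
Qed.

Lemma ext_scalar_mul k x :
  ext_mul (ext_scalar k) (ext_class x) = ext_class (scale_coc x k).
Proof.
rewrite ext_mulE; apply/ext_classP.
apply: cohom_trans (yonedaZl _ _ _) _; exact/scale_cohom/one_yoneda.
Qed.

Fact ext_scalarM : {morph ext_scalar : k l / k * l}.
Proof.
move=> k l; rewrite -[RHS]/(ext_mul _ _) ext_scalar_mul.
by apply/ext_classP/cohom_eq => n p; rewrite /= kactA.
Qed.

Fact ext_scalarC k a : ext_scalar k * a = a * ext_scalar k.
Proof.
elim/ext_ind: a => x; rewrite -[LHS]/(ext_mul _ _) -[RHS]/(ext_mul _ _).
rewrite ext_scalar_mul ext_mulE; apply/ext_classP/cohom_sym.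
apply: cohom_trans (yonedaZr _ _ _) _; exact/scale_cohom/yoneda1.
Qed.

HB.instance Definition _ := PzRing_isPzAlgebra.Build K ext
  ext_scalar1 ext_scalarD ext_scalarM ext_scalarC.

(* [ext_degree n] is the summand Ext^n_A(M, M). *)
Definition ext_degree (n : nat) (a : ext) :=
  exists2 x : cocycle, a = ext_class x & forall m p, m != n -> x m p = 0.

End Ext.

Section Graded.
(* [gr n] is the n-th homogeneous component of the graded algebra L. *)
Variables (K : fieldType) (L : pzAlgType K) (gr : nat -> L -> Prop).

Definition graded_radical (a : L) :=
  exists N (c : nat -> L),
    (forall i, gr i.+1 (c i)) /\ a = \sum_(i < N) c i.

(* m lies in M.S, for M a right module and S a subset of L. *)
Definition in_module_mul (M : rmodType L) (V : M -> Prop) (S : L -> Prop)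
    (m : M) :=
  exists N (v : 'I_N -> M) (a : 'I_N -> L),
    [/\ forall i, V (v i), forall i, S (a i) &
        m = \sum_(i < N) (a i : L^c) *: v i].

Definition is_grading (M : rmodType L) (deg : int -> M -> Prop) :=
  [/\ (forall i, deg i 0 /\ forall u v, deg i u -> deg i v -> deg i (u - v)),
      (forall i j m a, deg i m -> gr j a -> deg (i + j%:Z) ((a : L^c) *: m)),
      (forall m, exists (s : seq int) (c : int -> M),
         (forall i, deg i (c i)) /\ m = \sum_(i <- s) c i) &
      (forall (s : seq int) (c : int -> M), uniq s -> (forall i, deg i (c i)) ->
         \sum_(i <- s) c i = 0 -> forall i, i \in s -> c i = 0)].

Definition generated_in_degree (M : rmodType L) (deg : int -> M -> Prop)
    (d : int) :=
  forall m, in_module_mul (deg d) (fun=> True) m.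

(* The module L0 is graded with all of it in degree 0, which is what the      *)
(* third condition uses; minimality is im d^(n+1) <= P^n.r for all n.         *)
Definition minimal_graded (L0 : rmodType L) (P : resolution L0)
    (deg : forall n, int -> P n -> Prop) :=
  [/\ forall n, is_grading (deg n),
      forall n i p, deg n.+1 i p -> deg n i (res_d P n p),
      forall i p, deg 0%N i p -> i != 0 -> res_aug P p = 0 &
      forall n p, in_module_mul (fun=> True) graded_radical (res_d P n p)].

Definition delta (D A n : nat) : nat :=
  if n is 0 then 0
  else if n is 1 then 1
  else if odd n then n.-1./2 * D + A else n./2 * D.

Definition stacked (L0 : rmodType L) (D A : nat) :=
  exists (P : resolution L0) (deg : forall n, int -> P n -> Prop),
    minimal_graded deg /\
    forall n, le_gldim L^c n -> generated_in_degree (deg n) (delta D A n)%:Z.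

(* q presents L0 as the right module L / r, i.e. as Lambda_0. *)
Definition radical_quotient (L0 : rmodType L) (q : {linear (L^c)^o -> L0}) :=
  (forall m, exists a, q a = m) /\ (forall a : L, q a = 0 <-> graded_radical a).

Definition finite_dimensional :=
  exists N (b : 'I_N -> L),
    forall a, exists c : 'I_N -> K, a = \sum_(i < N) kscalar (c i) * b i.

End Graded.

Section QuiverQuotient.
Variables (K : fieldType) (Q : quiver) (L : pzAlgType K).
Variable pi : {rmorphism path_algebra K Q -> L}.

(* pi presents the K-algebra L as the quotient KQ / I. *)
Definition quotient_algebra (I : path_algebra K Q -> Prop) :=
  [/\ forall a, exists x, pi x = a,
      forall k, pi (kscalar k) = kscalar k &
      forall x, pi x = 0 <-> I x].

Definition length_degree (n : nat) (a : L) :=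
  exists2 x, length_homogeneous n x & a = pi x.

End QuiverQuotient.

(* Main.v *)
(* Let b = n - 2 >= 2 and let P be the minimal graded resolution.  Lift a dual *)
(* basis (y_i) of the top of P^b to chain maps l_i : P^(b+j) -> P^j.  Every    *)
(* f : P^n -> Lambda_0 has the form sum_i x_i o l_i with x_i : P^2 -> Lambda_0 *)
(* as soon as the l_i are jointly injective on the generators of P^n modulo    *)
(* the radical.  Here delta(n) = delta(b) + D is decisive.  If all l_i(p)      *)
(* vanish, write dp = sum_c w_c c with paths c of length                       *)
(* s = delta(n) - delta(b+1) and generators w_c of P^(b+1); then               *)
(* sum_c l_i(w_c) c = 0 in degree D of P^1.  The ideal I has no relations of   *)
(* length less than D (P^2 is generated in degree D), so this forces           *)
(* l_i(w_c) = 0, hence l_i(d w_c) = 0 in P^0, hence d w_c = 0, w_c = 0 and     *)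
(* p = 0.  So Ext^n = Ext^2 * Ext^(n-2) for 4 <= n <= gldim; comparison of     *)
(* resolutions carries this over to an arbitrary resolution.                   *)
Require Import Defs.
From HB Require Import structures.
From mathcomp Require Import all_boot all_order all_algebra.
From mathcomp Require Import finmap monalg boolp zify.
Set Implicit Arguments.
Unset Strict Implicit.
Unset Printing Implicit Defensive.
Import GRing.Theory.
Local Open Scope ring_scope.

(** * Linear algebra over a field *)

(** By induction on n it suffices that, for 4 <= n <= gldim, every class in Ext^n is a finite sum of
    products of a class in Ext^2 with a class in Ext^(n-2). Above gldim every class vanishes, by
    comparison with a resolution that is zero in degree n.

    On the minimal graded resolution, the lowest component of P^k sits in degree delta(k) and
    generates; it is called the top below. By minimality a map P^k -> Lambda_0 is a cocycle and
    depends only on the top ([to_L0_d], [top_factor]), so the claim becomes linear algebra: a linear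
    map that vanishes on the common kernel of finitely many functionals is a combination of them
    ([linear_combination_of_functionals]). The functionals are the coordinates of the top of P^2
    composed with the lifts h_i : P^n -> P^2 of a dual basis of the top of P^(n-2). That they detect
    the top of P^n is [lifts_inj]. The h_i need not be graded; one homogeneous component of each is
    used, and in P^0 = eps L it reads off coordinates ([lift_component]).

    The detection rests on three facts: differentials are injective on tops ([bd_inj]); distinct
    paths of equal length act freely from the right on KQ ([right_path_free]); I has no nonzero
    homogeneous element of length less than D ([no_short_relation]). The last two give
    [P1_right_free]. The degrees fit because delta(n) = delta(n-2) + D for n >= 4 ([delta_add2]); at
    n = 3 this fails unless A = 1, whence the generators of degree 3.

    The result passes to an arbitrary resolution by [comparison_homotopy] and [single_mul]. *)

Section LinearAlgebra.
Variables (K : fieldType) (V : lmodType K).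
Implicit Types (W : V -> Prop) (s t : seq V) (x y u : V).

Definition subspace W := W 0 /\ forall k x y, W x -> W y -> W (k *: x + y).

Fixpoint spanned s x : Prop :=
  if s is u :: s' then exists k : K, spanned s' (x - k *: u) else x = 0.

Lemma subspaceD W x y : subspace W -> W x -> W y -> W (x + y).
Proof. by case=> _ WP Wx Wy; rewrite -[x]scale1r; apply: WP. Qed.

Lemma subspaceZ W k x : subspace W -> W x -> W (k *: x).
Proof. by case=> W0 WP Wx; rewrite -[_ *: x]addr0; apply: WP. Qed.

Lemma subspaceB W x y : subspace W -> W x -> W y -> W (x - y).
Proof. by move=> WP Wx Wy; rewrite -scaleN1r addrC; apply: WP.2. Qed.

Lemma subspace_sum W I (r : seq I) (F : I -> V) :
  subspace W -> (forall i, W (F i)) -> W (\sum_(i <- r) F i).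
Proof.
by move=> WP WF; apply: big_ind => // [|x y]; [case: WP|apply: subspaceD].
Qed.

Lemma spanned_subspace s : subspace (spanned s).
Proof.
elim: s => [|u s [IH0 IH]] /=; first by split=> // k x y -> ->; rewrite scaler0 addr0.
split=> [|k x y [a xa] [b yb]]; first by exists 0; rewrite scale0r subr0.
exists (k * a + b); have := IH k _ _ xa yb.
by rewrite scalerBr scalerA scalerDl opprD addrACA.
Qed.

Lemma spanned_mem s u : u \in s -> spanned s u.
Proof.
elim: s => //= v s IH; rewrite inE => /orP[/eqP->|us].
  by exists 1; rewrite scale1r subrr; case: (spanned_subspace s).
by exists 0; rewrite scale0r subr0; apply: IH.
Qed.

Lemma spanned_min W s x :
  subspace W -> {in s, forall u, W u} -> spanned s x -> W x.
Proof.
move=> WP; elim: s x => /= [x _ ->|u s IH x su [k xk]]; first by case: WP.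
rewrite -[x](subrK (k *: u)); apply: subspaceD => //.
  by apply: IH => // v vs; apply: su; rewrite inE vs orbT.
by apply: subspaceZ => //; apply: su; rewrite mem_head.
Qed.

(** Induction on [s]: a spanning list for the part of W inside the span of the tail needs at most
    one more vector, some w in W congruent to the head u modulo that span. *)
Lemma subspace_spanned W s : subspace W -> (forall x, W x -> spanned s x) ->
  exists2 t, {in t, forall u, W u} & forall x, W x -> spanned t x.
Proof.
elim: s W => [|u s IH] W WP Ws; first by exists [::].
have sP := spanned_subspace s.
have [||t tW tP] := IH (fun x => W x /\ spanned s x); [|by move=> x []|].
  split; first by split; [case: WP|case: sP].
  by move=> k x y [? ?] [? ?]; split; [apply: WP.2|apply: sP.2].
have [[w [Ww ws]]|nw] := pselect (exists w, W w /\ spanned s (w - u)).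
  exists (w :: t) => [v|x Wx /=].
    by rewrite inE => /orP[/eqP->|/tW[]].
  have /= [k xk] := Ws x Wx; exists k; apply: tP; split.
    by apply: subspaceB => //; apply: subspaceZ.
  suff -> : x - k *: w = (x - k *: u) - k *: (w - u).
    by apply: subspaceB => //; apply: subspaceZ.
  by rewrite scalerBr opprB addrA subrK.
exists t => [v /tW[] //|x Wx]; apply: tP; split=> //.
have /= [k xk] := Ws x Wx; have [k0|nk] := eqVneq k 0.
  by move: xk; rewrite k0 scale0r subr0.
case: nw; exists (k^-1 *: x); split; first exact: subspaceZ.
suff -> : k^-1 *: x - u = k^-1 *: (x - k *: u) by apply: subspaceZ.
by rewrite scalerBr scalerA mulVf // scale1r.
Qed.

(** The [u i] form a basis of the quotient V / W extracted from [s], with coordinate functions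
    [phi i]. The induction enlarges W by the head v, which joins the basis exactly when it is not
    already in W. *)
Lemma coordinates_modulo W s : subspace W ->
  (forall x, exists2 y, spanned s y & W (x - y)) ->
  exists m (u : 'I_m -> V) (phi : 'I_m -> V -> K),
    [/\ forall i, u i \in s, forall i, scalar (phi i),
        forall i x, W x -> phi i x = 0 &
        forall x, W (x - \sum_i phi i x *: u i)].
Proof.
elim: s W => [|v s IH] W WP Ws.
  exists 0%N, (fun=> 0), (fun _ _ => 0); split=> [[]|[]|[]|x] //.
  by rewrite big_ord0; have [y /= ->] := Ws x.
pose W' x := exists k : K, W (x - k *: v).
have W'P : subspace W'.
  split=> [|k x y [a xa] [b yb]].
    by exists 0; rewrite scale0r subr0; case: WP.
  exists (k * a + b); have := WP.2 k _ _ xa yb.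
  by rewrite scalerBr scalerA scalerDl opprD addrACA.
have [|m [u [phi [us phiL phi0 uP]]]] := IH W' W'P.
  move=> x; have [y /= [k yk] Wxy] := Ws x; exists (y - k *: v) => //.
  by exists k; rewrite opprB addrA addrAC addrK.
have [Wv|nWv] := pselect (W v).
  exists m, u, phi; split=> [i||i x Wx|x] //; first by rewrite inE us orbT.
    by apply: phi0; exists 0; rewrite scale0r subr0.
  have [k xk] := uP x; rewrite -[_ - _](subrK (k *: v)).
  by apply: subspaceD => //; apply: subspaceZ.
(* The coordinate along v is picked by choice; as v is not in W it is unique ([kapU]), which is what
   makes it linear. *)
pose kap x := sval (cid (uP x)).
have kapP x : W (x - \sum_i phi i x *: u i - kap x *: v) := svalP (cid (uP x)).
have kapU x k : W (x - \sum_i phi i x *: u i - k *: v) -> kap x = k.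
  move=> Wk; apply/eqP; rewrite -subr_eq0; apply/negPn/negP => nz.
  apply: nWv; rewrite -[v]scale1r -(mulVf nz) -scalerA; apply: subspaceZ => //.
  have := subspaceB WP Wk (kapP x).
  by rewrite opprB [X in W X]addrC addrA subrK scalerBl.
exists m.+1, (fun i => oapp u v (unlift ord0 i)),
  (fun i => oapp phi kap (unlift ord0 i)); split=> [i|i|i x Wx|x].
- by case: unliftP => [j|] _ /=; rewrite inE ?us ?orbT ?eqxx.
- case: unliftP => [j|] _ /=; first exact: phiL.
  move=> k x y; apply: kapU.
  have := WP.2 k _ _ (kapP x) (kapP y); congr W.
  have -> : \sum_i phi i (k *: x + y) *: u i =
      k *: (\sum_i phi i x *: u i) + \sum_i phi i y *: u i.
    rewrite scaler_sumr -big_split /=; apply: eq_bigr => j _.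
    by rewrite (phiL j k x y) scalerDl scalerA.
  by rewrite !scalerBr scalerDl scalerA addrACA [_ - _ + _]addrACA -!opprD.
- have phx j : phi j x = 0 by apply: phi0; exists 0; rewrite scale0r subr0.
  case: unliftP => [j|] _ /=; first exact: phx.
  apply: kapU; rewrite scale0r subr0 big1 ?subr0 // => j _.
  by rewrite phx scale0r.
rewrite big_ord_recl /= unlift_none /=.
under eq_bigr => i _ do rewrite liftK /=.
by rewrite opprD addrA addrAC; apply: kapP.
Qed.

(** Induction on the functionals. If [psi t] is nonzero at some x0 killed by the others, its
    coefficient is g x0 / psi t x0; otherwise it vanishes on the common kernel of the others and
    gets coefficient 0. No finiteness of V is required. *)
Lemma linear_combination_of_functionals (U : lmodType K) (T : finType)
    (psi : T -> V -> K) (g : V -> U) :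
  (forall i, scalar (psi i)) -> linear g ->
  (forall x, (forall i, psi i x = 0) -> g x = 0) ->
  exists c : T -> U, forall x, g x = \sum_i psi i x *: c i.
Proof.
move=> psiL gL gker.
suff [c cP] : exists c : T -> U, forall x, g x = \sum_(i <- enum T) psi i x *: c i.
  by exists c => x; rewrite cP big_enum.
have {gker} : forall x, {in enum T, forall i, psi i x = 0} -> g x = 0.
  by move=> x h; apply: gker => i; apply: h; rewrite mem_enum.
elim: (enum T) (enum_uniq T) g gL => [|t l IH] /= => [_|/andP[tl ul]] g gL gker.
  by exists (fun=> 0) => x; rewrite big_nil; apply: gker.
have step (y : U) : (forall x, {in l, forall i, psi i x = 0} -> g x = psi t x *: y) ->
    exists c : T -> U, forall x, g x = \sum_(i <- t :: l) psi i x *: c i.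
  move=> gE; have [||c cP] := IH ul (fun x => g x - psi t x *: y).
  - move=> k x z; rewrite gL psiL scalerBr scalerA scalerDl opprD.
    by rewrite !addrA [_ + g z - _]addrAC.
  - by move=> x /gE ->; rewrite subrr.
  exists (fun i => if i == t then y else c i) => x.
  rewrite big_cons eqxx; have /(canRL (subrK _)) -> := cP x; rewrite addrC.
  congr (_ + _); rewrite !big_seq; apply: eq_bigr => i il.
  by case: eqP => // it; rewrite -it il in tl.
have [[x0 [x0l x0t]]|nx] :=
    pselect (exists x, {in l, forall i, psi i x = 0} /\ psi t x != 0).
  apply: (step ((psi t x0)^-1 *: g x0)) => x xl.
  have /eqP : g (- (psi t x / psi t x0) *: x0 + x) = 0.
    apply: gker => i; rewrite psiL mulNr inE => /orP[/eqP ->|il].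
      by rewrite divfK // addNr.
    by rewrite (x0l i il) (xl i il) mulr0 oppr0 addr0.
  by rewrite gL scaleNr addrC subr_eq0 scalerA => /eqP.
apply: (step 0) => x xl; rewrite scaler0; apply: gker => i.
rewrite inE => /orP[/eqP ->|/xl //].
by apply/eqP/negPn/negP => nz; apply: nx; exists x.
Qed.
End LinearAlgebra.

Lemma kscalar0 (K : fieldType) (A : pzAlgType K) : kscalar 0 = 0 :> A.
Proof. by apply: (addIr (kscalar 0)); rewrite -kscalarD !add0r. Qed.

(** * Supports and lengths in the path algebra *)

Section PathAlgebraSupport.
Variables (K : fieldType) (Q : quiver).
Local Notation KQ := (path_algebra K Q).
Implicit Types (x y z : KQ) (p q r t : qpath Q) (v w : vertex Q).

Definition vertex_idem v : KQ := path_elt K (trivial_path v).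

Lemma qcomp_someP p q r : qcomp p q = Some r ->
  qtarget p = qsource q /\ qpval r = (p.1, p.2 ++ q.2).
Proof.
case: (eqVneq (qtarget p) (qsource q)) => [pq|npq]; last by rewrite qcomp_None.
by have [r' -> r'E] := qcompP pq; case=> <-.
Qed.

Lemma qlength_comp p q r : qcomp p q = Some r ->
  qlength r = (qlength p + qlength q)%N.
Proof. by move=> /qcomp_someP[_ rE]; rewrite /qlength rE size_cat. Qed.

Lemma mcoeffU_neq0 c p r : (<< c *g p >> : KQ)@_r != 0 -> p = r /\ c != 0.
Proof. by rewrite mcoeffU; case: (p =P r) => //= _; rewrite mulr0n eqxx. Qed.

Lemma mcoeff_mul_neq0 x y r : (x * y)@_r != 0 ->
  exists p q, [/\ x@_p != 0, y@_q != 0 & qcomp p q = Some r].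
Proof.
rewrite -[x * y]/(path_mul x y) path_mul.unlock.
set C := exists p q, _.
pose N z := z@_r != 0 -> C.
have N0 : N 0 by rewrite /N mcoeff0 eqxx.
have ND a b : N a -> N b -> N (a + b).
  rewrite /N mcoeffD => Na Nb; case: (eqVneq (a@_r) 0) => [->|/Na //].
  by rewrite add0r.
apply: (big_ind N) => // p _; apply: (big_ind N) => // q _.
rewrite /N; case pq: (qcomp p q) => [r'|] /=; last by rewrite mcoeff0 eqxx.
case/mcoeffU_neq0 => rr; rewrite mulf_eq0 negb_or => /andP[xp yq].
by exists p, q; split=> //; rewrite pq rr.
Qed.

Definition length_ge (n : nat) x := forall p, x@_p != 0 -> (n <= qlength p)%N.

Lemma length_ge0 n : length_ge n 0.
Proof. by move=> p; rewrite mcoeff0 eqxx. Qed.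

Lemma length_geD n x y : length_ge n x -> length_ge n y -> length_ge n (x + y).
Proof.
move=> xn yn p; rewrite mcoeffD; case: (eqVneq (x@_p) 0) => [->|/xn //].
by rewrite add0r => /yn.
Qed.

Lemma length_geM m n x y :
  length_ge m x -> length_ge n y -> length_ge (m + n) (x * y).
Proof.
move=> xm yn r /mcoeff_mul_neq0[p [q [/xm pm /yn qn /qlength_comp ->]]].
exact: leq_add.
Qed.

Lemma length_geX n k x : length_ge n x -> length_ge (n * k) (x ^+ k).
Proof.
move=> xn; elim: k => [|k IH]; first by rewrite muln0.
by rewrite exprS mulnS; apply: length_geM.
Qed.

Lemma homogeneousD n x y :
  length_homogeneous n x -> length_homogeneous n y -> length_homogeneous n (x + y).
Proof.
move=> xn yn p; rewrite mcoeffD; case: (eqVneq (x@_p) 0) => [->|/xn //].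
by rewrite add0r => /yn.
Qed.

Lemma homogeneous0 n : length_homogeneous n (0 : KQ).
Proof. by move=> p; rewrite mcoeff0 eqxx. Qed.

Lemma homogeneousN n x : length_homogeneous n x -> length_homogeneous n (- x).
Proof. by move=> xn p; rewrite mcoeffN oppr_eq0 => /xn. Qed.

Lemma homogeneousM m n x y : length_homogeneous m x -> length_homogeneous n y ->
  length_homogeneous (m + n) (x * y).
Proof.
move=> xm yn r /mcoeff_mul_neq0[p [q [/xm pm /yn qn /qlength_comp ->]]].
by rewrite pm qn.
Qed.

Lemma homogeneousU c p : length_homogeneous (qlength p) (<< c *g p >> : KQ).
Proof.
by move=> r /mcoeffU_neq0[->].
Qed.

Lemma homogeneous_sum n I (r : seq I) (P : pred I) (F : I -> KQ) :
  (forall i, P i -> length_homogeneous n (F i)) ->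
  length_homogeneous n (\sum_(i <- r | P i) F i).
Proof.
move=> FP; apply: (big_ind (length_homogeneous n)) => //.
  exact: homogeneous0.
by move=> x y; apply: homogeneousD.
Qed.

Lemma kscalarU c p : kscalar c * path_elt K p = << c *g p >> :> KQ.
Proof.
rewrite -[LHS]path_scalerAl; have -> : path_mul 1 (path_elt K p) = path_elt K p.
  exact: path_mul1r.
by apply/malgP => r; rewrite mcoeffZ !mcoeffU mulrnAr mulr1.
Qed.

Lemma path_elt_sum x : x = \sum_(p <- msupp x) kscalar x@_p * path_elt K p.
Proof.
rewrite {1}[x]monalgE; apply: eq_bigr => p _; exact/esym/kscalarU.
Qed.

Lemma sum_homogeneous x k : length_ge k x ->
  exists N (c : nat -> KQ), [/\ forall i, length_homogeneous i (c i),
    forall i, (i < k)%N -> c i = 0 & x = \sum_(i < N) c i].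
Proof.
move=> xk; pose N := (\max_(p <- msupp x) qlength p).+1; exists N.
pose c i : KQ := \sum_(p <- msupp x | qlength p == i) << x@_p *g p >>.
have cH i : length_homogeneous i (c i).
  by apply: homogeneous_sum => p /eqP <-; apply: homogeneousU.
exists c; split=> // [i ik|].
  rewrite /c big_seq_cond big1 // => p /andP[px /eqP pi].
  by have := xk p; rewrite -mcoeff_neq0 in px; move/(_ px); rewrite pi leqNgt ik.
rewrite {1}[x]monalgE /c (exchange_big_dep predT) //=.
rewrite !big_seq; apply: eq_bigr => p px.
have pN : (qlength p < N)%N by rewrite ltnS; apply: leq_bigmax_seq.
by rewrite (big_pred1 (Ordinal pN)) // => i; rewrite -val_eqE eq_sym.
Qed.

Lemma sum_idem : 1 = \sum_v vertex_idem v :> KQ.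
Proof. by []. Qed.

Lemma idemM v w : vertex_idem v * vertex_idem w = if v == w then vertex_idem v else 0.
Proof.
rewrite -[LHS]/(path_mul << 1 *g _ >> << 1 *g _ >>) path_mulUU qcomp_trivl mul1r.
by rewrite /qsource /=; case: eqVneq => // ->.
Qed.

Lemma homogeneous_idem v : length_homogeneous 0 (vertex_idem v).
Proof. by rewrite -[0%N]/(qlength (trivial_path v)); apply: homogeneousU. Qed.

Lemma path_elt_idem p : path_elt K (trivial_path (qsource p)) * path_elt K p = path_elt K p.
Proof.
rewrite -[LHS]/(path_mul << 1 *g _ >> << 1 *g _ >>) path_mulUU qcomp_trivl eqxx.
by rewrite mul1r.
Qed.

(** Concatenation is cancellable: r is the only path with r p = t. *)
Lemma mul_path_elt_coef x p r t : qcomp r p = Some t ->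
  (x * path_elt K p)@_t = x@_r.
Proof.
move=> rt; pose y := x - << x@_r *g r >>.
have yr : y@_r = 0 by rewrite mcoeffB mcoeffUU subrr.
rewrite -[x in LHS](subrK << x@_r *g r >>) -/y mulrDl mcoeffD.
rewrite -[_ * _ in X in _ + X]/(path_mul _ << 1 *g p >>) path_mulUU rt mulr1.
rewrite mcoeffUU; suff -> : (y * path_elt K p)@_t = 0 by rewrite add0r.
apply/eqP/negPn/negP => /mcoeff_mul_neq0[r' [p' [yr' pp' rt']]].
have [pE _] := mcoeffU_neq0 pp'.
move: yr'; suff -> : r' = r by rewrite yr eqxx.
have [_ tE] := qcomp_someP rt; have [_] := qcomp_someP rt'.
rewrite tE -pE => -[e1 /eqP]; rewrite eqseq_cat; last first.
  have := qlength_comp rt; rewrite (qlength_comp rt') pE => /eqP.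
  by rewrite eqn_add2r => /eqP.
case/andP=> /eqP e2 _; apply: val_inj; rewrite /=.
by rewrite (surjective_pairing (qpval r)) (surjective_pairing (qpval r')) e1 e2.
Qed.

(** A path has only one suffix of length s, so the products r p for different p never meet, and the
    coefficients of each [m p] can be read in the sum. *)
Lemma right_path_free (l : seq (qpath Q)) s (m : qpath Q -> KQ) :
  uniq l -> {in l, forall p, qlength p = s} ->
  {in l, forall p, m p * vertex_idem (qsource p) = m p} ->
  \sum_(p <- l) m p * path_elt K p = 0 -> {in l, forall p, m p = 0}.
Proof.
move=> lu ls me m0 p pl; apply/malgP => r; rewrite mcoeff0.
have [rp|nrp] := eqVneq (qtarget r) (qsource p); last first.
  apply/eqP/negPn/negP; rewrite -(me p pl) => /mcoeff_mul_neq0[r' [p' [_ ep rE]]].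
  have [pE _] := mcoeffU_neq0 ep.
  have := qcomp_trivr (qsource p) r'; rewrite pE rE; case: eqP => // e [re].
  by rewrite re e eqxx in nrp.
have [t rt tE] := qcompP rp.
have := congr1 (mcoeff t) m0; rewrite mcoeff0 raddf_sum (bigD1_seq p) //=.
rewrite (mul_path_elt_coef _ rt) big_seq_cond big1 ?addr0 // => p' /andP[p'l pp'].
apply/eqP/negPn/negP => /mcoeff_mul_neq0[r' [p'' [_ pp'' rt']]].
have [pE _] := mcoeffU_neq0 pp''.
case/eqP: pp'; have [tp' tE'] := qcomp_someP rt'.
move: tE'; rewrite tE -pE => -[e1 /eqP]; rewrite eqseq_cat; last first.
  have := qlength_comp rt; rewrite (qlength_comp rt') -pE (ls p') // (ls p) // => /eqP.
  by rewrite eqn_add2r => /eqP.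
case/andP=> /eqP e2 /eqP e3; apply: val_inj => /=.
have sE : qsource p' = qsource p.
  by rewrite pE -tp' -rp /qtarget e1 e2.
rewrite (surjective_pairing (qpval p)) (surjective_pairing (qpval p')) -e3.
by move: sE; rewrite /qsource => ->.
Qed.

Lemma path_elt_cons j p : qlength p = j.+1 -> exists a p',
  qlength p' = j /\ path_elt K p = path_elt K (arrow_path a) * path_elt K p'.
Proof.
case: p => -[v [|a s]] //= pP [sj]; have /andP[av sP] := pP.
exists a, (@QPath Q (target a, s) sP); split=> //.
rewrite -[RHS]/(path_mul << 1 *g _ >> << 1 *g _ >>) path_mulUU mul1r.
have e : qtarget (arrow_path a) = qsource (@QPath Q (target a, s) sP) by [].
have [r -> rE] := qcompP e; rewrite /path_elt /=; congr (<< _ >>).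
by apply: val_inj; rewrite /= rE /= (eqP av).
Qed.

Lemma homogeneous_decomp j z : length_homogeneous j.+1 z ->
  exists (l : seq (qpath Q)) (A B : qpath Q -> KQ),
  [/\ forall p, length_homogeneous 1 (A p), forall p, length_homogeneous j (B p) &
      z = \sum_(p <- l) A p * B p].
Proof.
move=> zj; have ex p : exists AB : KQ * KQ, [/\ length_homogeneous 1 AB.1,
    length_homogeneous j AB.2 & z@_p != 0 -> kscalar z@_p * path_elt K p = AB.1 * AB.2].
  have [zp|zp] := eqVneq (z@_p) 0.
    (* Off the support of z the pair is a mere default, kept homogeneous. *)
    by exists (0, 0); split=> //; apply: homogeneous0.
  have [a [p' [p'j ->]]] := path_elt_cons (zj p zp).
  exists (<< z@_p *g arrow_path a >>, path_elt K p'); split=> /=.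
  - exact: homogeneousU.
  - by rewrite -p'j; apply: homogeneousU.
  by rewrite mulrA kscalarU.
pose AB p := sval (cid (ex p)).
exists (msupp z), (fun p => (AB p).1), (fun p => (AB p).2).
split=> [p|p|]; try by have [] := svalP (cid (ex p)).
rewrite {1}[z]path_elt_sum !big_seq; apply: eq_bigr => p pz.
by have [_ _ ->] := svalP (cid (ex p)); rewrite ?mcoeff_neq0.
Qed.

Lemma ideal_gen_ideal (R : pzRingType) (G : R -> Prop) : is_ideal (ideal_gen G).
Proof.
split=> [I|a b aG bG I|a b c bG I] IP GI; have [I0 ID IM] := IP => //.
  by apply: ID; [apply: aG|apply: bG].
by apply: IM; apply: bG.
Qed.

Lemma ideal_exp_ideal (R : pzRingType) (I : R -> Prop) n : is_ideal (ideal_exp I n).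
Proof. by case: n => [|n] //; apply: ideal_gen_ideal. Qed.

Lemma length_ge_arrow_ideal n x : length_ge n x ->
  ideal_exp (@arrow_ideal K Q) n x.
Proof.
move=> xn; have [J0 JD JM] := ideal_exp_ideal (@arrow_ideal K Q) n.
rewrite [x]path_elt_sum big_seq; apply: big_ind => // p px.
rewrite -[_ * _]mulr1; apply: JM.
have {xn px x} : (n <= qlength p)%N by apply: xn; rewrite mcoeff_neq0.
elim: n p {J0 JD} => //= n IH p np.
have [|a [p' [p'j ->]]] := @path_elt_cons (qlength p).-1 p.
  by rewrite prednK //; apply: leq_trans np.
move=> I IP IG; apply: IG; exists (path_elt K (arrow_path a)), (path_elt K p').
split=> //; first by move=> I' _; apply; exists a.
by apply: IH; rewrite p'j -ltnS prednK //; apply: leq_trans np.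
Qed.

Lemma arrow_ideal_sqr_length x : ideal_exp (@arrow_ideal K Q) 2 x -> length_ge 2 x.
Proof.
have geI n : is_ideal (length_ge n).
  split; [exact: length_ge0|exact: length_geD|move=> a b c bn].
  rewrite -[n]addn0 -[n]add0n.
  by do 2![apply: length_geM => //].
have J1 y : arrow_ideal y -> length_ge 1 y.
  by apply=> // _ [a ->] p /homogeneousU ->.
have J2 y : ideal_mul (@arrow_ideal K Q) (fun=> True) y -> length_ge 1 y.
  apply=> // _ [a [b [/J1 a1 _ ->]]]; rewrite -[1%N]addn0.
  exact: length_geM.
apply=> // _ [a [b [/J1 a1 /J2 b1 ->]]]; exact: (length_geM a1 b1).
Qed.

End PathAlgebraSupport.

(** * Graded modules and the length grading *)

Local Notation "x ** a" := ((a : (_)^c) *: x) (at level 40).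

Lemma ractM (R : pzRingType) (M : lmodType R^c) (x : M) (a b : R) :
  x ** (a * b) = (x ** a) ** b.
Proof. by rewrite scalerA. Qed.

Section Components.
Variables (K : fieldType) (L : pzAlgType K) (gr : nat -> L -> Prop).
Variables (M : rmodType L) (deg : int -> M -> Prop) (G : is_grading gr deg).
Implicit Types (m x y : M) (d : int -> M) (i j : int).

Lemma deg0 i : deg i 0. Proof. by case: G => /(_ i)[]. Qed.

Lemma degB i x y : deg i x -> deg i y -> deg i (x - y).
Proof. by case: G => /(_ i)[_ dB] _ _ _; apply: dB. Qed.

Lemma degN i x : deg i x -> deg i (- x).
Proof. by move=> dx; rewrite -sub0r; apply: degB => //; apply: deg0. Qed.

Lemma degD i x y : deg i x -> deg i y -> deg i (x + y).
Proof. by move=> dx dy; rewrite -[y]opprK; apply: degB => //; apply: degN. Qed.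

Lemma deg_sum i I (r : seq I) (P : pred I) (F : I -> M) :
  (forall k, P k -> deg i (F k)) -> deg i (\sum_(k <- r | P k) F k).
Proof. by move=> FP; apply: big_ind => //; [apply: deg0|apply: degD]. Qed.

Lemma deg_act i (j : nat) x (a : L) : deg i x -> gr j a -> deg (i + j%:Z) (x ** a).
Proof. by case: G => _ dA _ _; apply: dA. Qed.

(** The grading axiom allows repeated degrees in its list; a finitely supported family without
    repetition is what makes components unique. *)
Definition decomposes m d := exists t, [/\ uniq t, forall i, deg i (d i),
  forall i, i \notin t -> d i = 0 & m = \sum_(i <- t) d i].

Lemma decomposes_widen m d t t' : uniq t -> uniq t' -> {subset t <= t'} ->
  (forall i, i \notin t -> d i = 0) -> \sum_(i <- t') d i = \sum_(i <- t) d i.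
Proof.
move=> tu t'u tt' d0; rewrite (bigID (mem t)) /= addrC big1 // add0r -big_filter.
apply: perm_big; apply: uniq_perm => //; first exact: filter_uniq.
move=> i; rewrite mem_filter; case: (boolP (i \in t)) => //=; exact: tt'.
Qed.

Lemma decomposesB m m' d d' : decomposes m d -> decomposes m' d' ->
  decomposes (m - m') (fun i => d i - d' i).
Proof.
move=> [t [tu dd d0 ->]] [t' [tu' dd' d0' ->]]; exists (undup (t ++ t')).
split=> [|i|i|]; first exact: undup_uniq.
- exact: degB.
- by rewrite mem_undup mem_cat negb_or => /andP[/d0 -> /d0' ->]; rewrite subrr.
rewrite sumrB; congr (_ - _); apply/esym/decomposes_widen => //;
  rewrite ?undup_uniq // => i it; by rewrite mem_undup mem_cat it ?orbT.
Qed.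

Lemma decomposes1 i m : deg i m -> decomposes m (fun j => if j == i then m else 0).
Proof.
move=> dm; exists [:: i]; split=> // [j|j|]; last by rewrite big_seq1 eqxx.
  by case: eqP => [->|_] //; apply: deg0.
by rewrite inE => /negbTE ->.
Qed.

Lemma decomposes0 : decomposes 0 (fun=> 0).
Proof. by exists [::]; split=> // [i|]; [apply: deg0|rewrite big_nil]. Qed.

Lemma decomposesD m m' d d' : decomposes m d -> decomposes m' d' ->
  decomposes (m + m') (fun i => d i + d' i).
Proof.
move=> md md'; have := decomposesB md (decomposesB decomposes0 md').
by rewrite sub0r opprK; congr decomposes; apply: funext => i; rewrite sub0r opprK.
Qed.

Lemma decomposes_exists m : exists d, decomposes m d.
Proof.
case: G => _ _ /(_ m)[s [c [cd ->]]] _; elim: s => [|i s [d dP]].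
  by exists (fun=> 0); rewrite big_nil; apply: decomposes0.
rewrite big_cons; exists (fun j => (if j == i then c i else 0) + d j).
by apply: decomposesD => //; apply: decomposes1.
Qed.

Definition component i m : M := sval (cid (decomposes_exists m)) i.

Lemma componentP m : decomposes m (component^~ m).
Proof. exact: svalP (cid (decomposes_exists m)). Qed.

Lemma componentE m d : decomposes m d -> forall i, component i m = d i.
Proof.
move=> md i; apply/eqP; rewrite -subr_eq0.
have [t [tu dd d0 /esym s0]] := decomposesB (componentP m) md.
rewrite subrr in s0; case: (boolP (i \in t)) => [it|/d0 /eqP //].
case: G => _ _ _ /(_ t _ tu dd s0 i it) /eqP //.
Qed.

Lemma component_deg i m : deg i (component i m).
Proof. by have [t [_ + _ _]] := componentP m; apply. Qed.

Lemma component_sum_all m : exists2 t, uniq t & m = \sum_(i <- t) component i m.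
Proof. by have [t [tu _ _ mE]] := componentP m; exists t. Qed.

Lemma component_id i m : deg i m -> component i m = m.
Proof. by move=> /decomposes1/componentE ->; rewrite eqxx. Qed.

Lemma component_neq i j m : deg i m -> j != i -> component j m = 0.
Proof. by move=> /decomposes1/componentE -> /negbTE ->. Qed.

Lemma component0 i : component i 0 = 0.
Proof. exact: (componentE decomposes0). Qed.

Lemma componentD i x y : component i (x + y) = component i x + component i y.
Proof. exact: (componentE (decomposesD (componentP x) (componentP y))). Qed.

Lemma componentB i x y : component i (x - y) = component i x - component i y.
Proof. exact: (componentE (decomposesB (componentP x) (componentP y))). Qed.

Lemma component_sum i I (r : seq I) (P : pred I) (F : I -> M) :
  component i (\sum_(k <- r | P k) F k) = \sum_(k <- r | P k) component i (F k).
Proof. exact: (big_morph _ (componentD i) (component0 i)). Qed.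

Lemma component_act i (j : nat) x (a : L) : gr j a ->
  component i (x ** a) = component (i - j%:Z) x ** a.
Proof.
move=> ga; have [t [tu dd d0 xE]] := componentP x.
apply: (@componentE _ (fun i => component (i - j%:Z) x ** a)).
exists [seq k + j%:Z | k <- t]; split=> [|k|k kt|].
- by rewrite map_inj_uniq //; apply: addIr.
- by rewrite -{1}[k](subrK j%:Z); apply: deg_act.
- rewrite d0 ?scaler0 //; apply: contra kt => kt.
  by rewrite -[k](subrK j%:Z); apply: map_f.
rewrite big_map {1}xE scaler_sumr; apply: eq_bigr => k _.
by rewrite addrK.
Qed.

End Components.

Lemma component_morph (K : fieldType) (L : pzAlgType K) (gr : nat -> L -> Prop)
    (M N : rmodType L) (deg : int -> M -> Prop) (deg' : int -> N -> Prop)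
    (G : is_grading gr deg) (G' : is_grading gr deg') (f : {linear M -> N}) i x :
  (forall i x, deg i x -> deg' i (f x)) ->
  component G' i (f x) = f (component G i x).
Proof.
move=> fd; have [t [tu dd d0 xE]] := componentP G x.
apply: (componentE G' (d := fun i => f (component G i x))).
exists t; split=> // [j|j /d0 ->|]; first exact: fd.
  by rewrite linear0.
by rewrite {1}xE linear_sum.
Qed.

(** * The length grading of KQ / I, its radical, and maps into Lambda_0 *)

Section LengthGrading.
Variables (K : fieldType) (Q : quiver) (I : path_algebra K Q -> Prop).
Variables (L : pzAlgType K) (pi : {rmorphism path_algebra K Q -> L}).
Variables (L0 : rmodType L) (q : {linear (L^c)^o -> L0}).
Hypotheses (I_adm : admissible I) (piP : quotient_algebra pi I).
Hypothesis (qP : radical_quotient (length_degree pi) q).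

Local Notation gr := (length_degree pi).
Local Notation rad := (graded_radical gr).
Local Notation idem v := (pi (vertex_idem K v)).

Lemma gr0 n : gr n 0.
Proof. by exists 0; rewrite ?rmorph0 //; apply: homogeneous0. Qed.

Lemma grD n a b : gr n a -> gr n b -> gr n (a + b).
Proof.
move=> [x xn ->] [y yn ->]; exists (x + y); rewrite ?rmorphD //.
exact: homogeneousD.
Qed.

Lemma grM m n a b : gr m a -> gr n b -> gr (m + n) (a * b).
Proof.
move=> [x xn ->] [y yn ->]; exists (x * y); rewrite ?rmorphM //.
exact: homogeneousM.
Qed.

Lemma gr_sum n J (r : seq J) (P : pred J) (F : J -> L) :
  (forall k, P k -> gr n (F k)) -> gr n (\sum_(k <- r | P k) F k).
Proof. by move=> FP; apply: big_ind => //; [apply: gr0|apply: grD]. Qed.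

Lemma gr_scalar k : gr 0 (kscalar k).
Proof.
case: piP => _ <- _; exists (kscalar k) => //.
rewrite -[kscalar k]mulr1 sum_idem mulr_sumr; apply: homogeneous_sum => v _.
by rewrite kscalarU -[0%N]/(qlength (trivial_path v)); apply: homogeneousU.
Qed.

Lemma gr_idem v : gr 0 (idem v).
Proof. by exists (vertex_idem K v) => //; apply: homogeneous_idem. Qed.

Lemma pi_surj a : exists x, pi x = a. Proof. by case: piP. Qed.

Lemma pi_scalar k : pi (kscalar k) = kscalar k. Proof. by case: piP. Qed.

Lemma radP a : rad a <-> exists2 x, length_ge 1 x & a = pi x.
Proof.
split=> [[N [c [cg ->]]]|[x x1 ->]].
  apply: (big_ind (fun a => exists2 x, length_ge 1 x & a = pi x)).
  - by exists 0; rewrite ?rmorph0 //; apply: length_ge0.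
  - move=> _ _ [x x1 ->] [y y1 ->]; exists (x + y); rewrite ?rmorphD //.
    exact: length_geD.
  by move=> i _; have [x xi ->] := cg i; exists x => // p /xi ->.
have [N [c [cH c0 ->]]] := sum_homogeneous x1; case: N => [|N].
  by exists 0%N, (fun=> 0); split=> [i|]; [apply: gr0|rewrite !big_ord0 rmorph0].
exists N, (fun i => pi (c i.+1)); split=> [i|]; first by exists (c i.+1).
by rewrite big_ord_recl c0 // add0r rmorph_sum.
Qed.

Lemma gr_rad n a : gr n.+1 a -> rad a.
Proof. by move=> [x xn ->]; apply/radP; exists x => // p /xn ->. Qed.

Lemma rad_mull a b : rad b -> rad (a * b).
Proof.
move=> /radP[y y1 ->]; have [x <-] := pi_surj a; apply/radP.
by exists (x * y); rewrite ?rmorphM // -[1%N]add0n; apply: length_geM.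
Qed.

Lemma rad_nilpotent : exists N, forall a, rad a -> a ^+ N = 0.
Proof.
have [_ [N _ NI] _] := I_adm; exists N => a /radP[x x1 ->].
case: piP => _ _ piI; rewrite -rmorphXn; apply/piI/NI/length_ge_arrow_ideal.
by have := length_geX (k := N) x1; rewrite mul1n.
Qed.

(** Admissibility puts I inside the square of the arrow ideal, where all lengths are at least 2. *)
Lemma pi_low z n : (n < 2)%N -> length_homogeneous n z -> pi z = 0 -> z = 0.
Proof.
move=> n2 zn z0; have [_ _ I2] := I_adm.
case: piP => _ _ /(_ z)[/(_ z0)/I2/arrow_ideal_sqr_length z2 _].
apply/malgP => p; rewrite mcoeff0; apply/eqP/negPn/negP => zp.
by have := z2 p zp; rewrite (zn p zp) leqNgt n2.
Qed.

Lemma algebra_decomp a : exists N (c : nat -> L),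
  (forall i, gr i (c i)) /\ a = \sum_(i < N) c i.
Proof.
have [x <-] := pi_surj a.
have [|N [c [cH _ ->]]] := @sum_homogeneous _ _ x 0 => //.
by exists N, (fun i => pi (c i)); rewrite rmorph_sum; split=> // i; exists (c i).
Qed.

Lemma sum_act_idem (M : rmodType L) (x : M) : x = \sum_v x ** idem v.
Proof.
have e1 : \sum_v idem v = 1 :> L by rewrite -rmorph_sum -sum_idem rmorph1.
rewrite -scaler_suml -[LHS]scale1r; congr (_ *: _); exact/esym/e1.
Qed.

Lemma act_idemM (M : rmodType L) (x : M) v w :
  (x ** idem v) ** idem w = if v == w then x ** idem v else 0.
Proof.
rewrite -ractM -rmorphM idemM; case: eqP => // _.
by rewrite rmorph0 scale0r.
Qed.

Lemma qM (a b : L) : q (a * b : L) = q a ** b.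
Proof. by rewrite -linearZ. Qed.

Lemma L0_rad (z : L0) a : rad a -> z ** a = 0.
Proof.
move=> ra; case: qP => /(_ z)[b <-] q0; rewrite -qM.
by apply/q0/rad_mull.
Qed.

(** Modulo the radical, which kills [L0], the algebra is spanned over K by the vertex idempotents,
    so linearity need only be tested on scalars, idempotents and positive degrees. *)
Lemma linear_to_L0 (M : rmodType L) (f : M -> L0) :
  {morph f : x y / x + y} ->
  (forall k x, f (x ** kscalar k) = f x ** kscalar k) ->
  (forall v x, f (x ** idem v) = f x ** idem v) ->
  (forall n a x, gr n.+1 a -> f (x ** a) = 0) ->
  linear (f : M -> L0).
Proof.
move=> fD fk fe fr a x y; rewrite fD; congr (_ + _).
have f0 : f 0 = 0 by apply: (addIr (f 0)); rewrite -fD !add0r.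
have := algebra_decomp a => -[N [c [cg ->]]].
rewrite !scaler_suml (big_morph f fD f0); apply: eq_bigr => -[[|i] _] /= _; last first.
  by rewrite (fr i) // L0_rad //; apply: gr_rad (cg _).
have [z z0 ->] := cg 0%N; rewrite [z]path_elt_sum rmorph_sum !scaler_suml.
rewrite (big_morph f fD f0) !big_seq; apply: eq_bigr => p pz.
have : qlength p = 0 by apply: z0; rewrite mcoeff_neq0.
rewrite rmorphM pi_scalar !ractM => p0.
have -> : path_elt K p = vertex_idem K (qsource p).
  congr path_elt; apply: val_inj => /=; rewrite /qsource.
  by case: p p0 {pz} => -[v []].
by rewrite fe fk.
Qed.

Lemma homogeneous_sum_paths n b : gr n b -> exists l (c : qpath Q -> K),
  [/\ uniq l, {in l, forall p, qlength p = n} &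
      b = \sum_(p <- l) kscalar (c p) * pi (path_elt K p)].
Proof.
move=> [z zn ->]; exists (msupp z), (fun p => z@_p); split=> [|p pz|].
- exact: fset_uniq.
- by apply: zn; rewrite mcoeff_neq0.
by rewrite {1}[z]path_elt_sum rmorph_sum; apply: eq_bigr => p _; rewrite rmorphM pi_scalar.
Qed.

End LengthGrading.

(** * The minimal graded resolution *)

(** An alias of V that carries the K-vector space structure, so that the linear algebra over a field
    applies to right L-modules. *)
Definition kmod (K : fieldType) (L : pzAlgType K) (V : rmodType L) : Type := V.
HB.instance Definition _ K L V := GRing.Zmodule.on (@kmod K L V).

Section KModule.
Variables (K : fieldType) (L : pzAlgType K) (V : rmodType L).

Fact kmod_scaleA (k l : K) (v : kmod V) : kact k (kact l (v : V)) = kact (k * l) (v : V).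
Proof. by rewrite kactA. Qed.
Fact kmod_scaleDr : right_distributive (fun k (v : kmod V) => kact k (v : V) : kmod V) +%R.
Proof. by move=> k u v; apply: kactDr. Qed.
Fact kmod_scaleDl (v : kmod V) :
  {morph (fun k => kact k (v : V) : kmod V) : k l / k + l}.
Proof. by move=> k l; apply: kactDl. Qed.

HB.instance Definition _ := GRing.Zmodule_isLmodule.Build K (kmod V)
  kmod_scaleA (@kact1 K L V) kmod_scaleDr kmod_scaleDl.

Lemma kact_ract k (x : V) a : kact k (x ** a) = kact k x ** a.
Proof. by rewrite /kact -!ractM kscalarC. Qed.

Lemma kmod_subspace_im (U : rmodType L) (f : {linear U -> V}) :
  subspace (fun y : kmod V => exists x, f x = y).
Proof.
split=> [|k _ _ [x <-] [y <-]]; first by exists 0; rewrite linear0.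
by exists (kact k x + y); rewrite linearD linear_kact.
Qed.

End KModule.

Section MinimalResolution.
Variables (K : fieldType) (Q : quiver) (I : path_algebra K Q -> Prop).
Variables (L : pzAlgType K) (pi : {rmorphism path_algebra K Q -> L}).
Variables (L0 : rmodType L) (q : {linear (L^c)^o -> L0}).
Hypotheses (I_adm : admissible I) (piP : quotient_algebra pi I).
Hypothesis (L_fd : finite_dimensional L).
Hypothesis (qP : radical_quotient (length_degree pi) q).

Local Notation gr := (length_degree pi).
Local Notation rad := (graded_radical gr).
Local Notation idem v := (pi (vertex_idem K v)).

Variables (P : resolution L0) (deg : forall n, int -> P n -> Prop).
Hypothesis P_min : minimal_graded gr deg.
Arguments deg : clear implicits.
(* dl m is the degree generating P^m, for m <= n only: above the global       *)
(* dimension a stacked algebra is not required to satisfy anything.           *)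
Variables (dl : nat -> nat) (n : nat).
Hypothesis dl0 : dl 0%N = 0%N.
Hypothesis P_gen : forall m, (m <= n)%N -> generated_in_degree (deg m) (dl m)%:Z.

Fact P_grading m : is_grading gr (deg m). Proof. by case: P_min. Qed.
Local Notation cmp m := (component (P_grading m)).
Local Notation V m := (deg m (dl m)%:Z).
Implicit Types m t : nat.

Lemma d_deg m i x : deg m.+1 i x -> deg m i (res_d P m x).
Proof. by case: P_min => _ /(_ m i x). Qed.

Lemma cmp_d m i x : cmp m i (res_d P m x) = res_d P m (cmp m.+1 i x).
Proof. by apply: component_morph => j y; apply: d_deg. Qed.

Lemma cmp_kact m i k x : cmp m i (kact k x) = kact k (cmp m i x).
Proof. by rewrite /kact (component_act _ _ _ (gr_scalar piP k)) subr0. Qed.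

Lemma gen_low m i x a : V m x -> i < (dl m)%:Z -> cmp m i (x ** a) = 0.
Proof.
move=> Vx im; have [N [c [cg ->]]] := algebra_decomp piP a.
rewrite scaler_suml component_sum big1 // => j _.
rewrite (component_act _ _ _ (cg j)) (component_neq _ Vx) ?scaler0 //.
by apply/eqP; lia.
Qed.

Lemma component_low m i x : (m <= n)%N -> i < (dl m)%:Z -> cmp m i x = 0.
Proof.
move=> mn im; have [N [v [a [vV _ ->]]]] := P_gen mn x.
by rewrite component_sum big1 // => j _; apply: gen_low.
Qed.

Lemma deg_low m i x : (m <= n)%N -> deg m i x -> i < (dl m)%:Z -> x = 0.
Proof. by move=> mn dx im; rewrite -(component_id (P_grading m) dx) component_low. Qed.

Lemma gen_component m t x a : V m x ->
  exists2 b, gr t b & cmp m ((dl m)%:Z + t%:Z) (x ** a) = x ** b.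
Proof.
move=> Vx; have [N [c [cg ->]]] := algebra_decomp piP a.
exists (\sum_(j < N | j == t :> nat) c j); first by apply: gr_sum => j /eqP <-.
rewrite !scaler_suml component_sum [RHS]big_mkcond /=; apply: eq_bigr => j _.
rewrite (component_act _ _ _ (cg j)); case: eqP => [->|jt].
  by rewrite addrK (component_id _ Vx).
by rewrite (component_neq _ Vx) ?scaler0 //; apply/eqP; lia.
Qed.

Lemma deg_gen m t x : (m <= n)%N -> deg m ((dl m)%:Z + t%:Z) x ->
  exists N (v : 'I_N -> P m) (b : 'I_N -> L),
    [/\ forall k, V m (v k), forall k, gr t (b k) & x = \sum_k v k ** b k].
Proof.
move=> mn dx; have [N [v [a [vV _ xE]]]] := P_gen mn x.
pose b k := sval (cid2 (gen_component t (a k) (vV k))).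
have bP k := svalP (cid2 (gen_component t (a k) (vV k))).
exists N, v, b; split=> // [k|]; first by have [] := bP k.
rewrite -(component_id (P_grading m) dx) xE component_sum.
by apply: eq_bigr => k _; have [_ ->] := bP k.
Qed.

Lemma cmp_act_gr m t x a : (m <= n)%N -> gr t.+1 a -> cmp m (dl m)%:Z (x ** a) = 0.
Proof.
move=> mn ga; rewrite (component_act _ _ _ ga) component_low ?scale0r ?scaler0 //.
by lia.
Qed.

Lemma cmp_top_rad m x :
  (m <= n)%N -> in_module_mul (fun=> True) rad x -> cmp m (dl m)%:Z x = 0.
Proof.
move=> mn [N [v [a [_ ra ->]]]]; rewrite component_sum big1 // => k _.
have [M [c [cg ->]]] := ra k; rewrite scaler_suml component_sum big1 // => j _.
exact: (cmp_act_gr _ mn (cg j)).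
Qed.

Lemma cmp_top_d m x : (m <= n)%N -> cmp m (dl m)%:Z (res_d P m x) = 0.
Proof. by move=> mn; apply: cmp_top_rad => //; case: P_min. Qed.

(** Exactness makes a cycle a boundary, and minimality puts boundaries in P.r, strictly above the
    generating degree. *)
Lemma cmp_top_ker m x : (m <= n)%N -> bd P m x = 0 -> cmp m (dl m)%:Z x = 0.
Proof. by move=> mn /bd_exact[y <-]; apply: cmp_top_d. Qed.

Lemma bd_inj m x : (m <= n)%N -> V m x -> bd P m x = 0 -> x = 0.
Proof.
by move=> mn Vx /(cmp_top_ker mn); rewrite (component_id _ Vx).
Qed.

(** There is nothing below degree [dl m], and what lies above is generated by the top under positive
    degrees, which g kills. Additivity suffices, so that g may be a map into [L0] or a single
    component of a chain map. *)
Lemma top_factor m (U : zmodType) (g : P m -> U) x : (m <= n)%N ->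
  {morph g : y z / y + z} ->
  (forall t v b, V m v -> gr t.+1 b -> g (v ** b) = 0) ->
  g x = g (cmp m (dl m)%:Z x).
Proof.
move=> mn gD g0; have gz : g 0 = 0 by apply: (addIr (g 0)); rewrite -gD !add0r.
rewrite -[x in LHS](subrK (cmp m (dl m)%:Z x)) gD; set y := x - _.
have yc : cmp m (dl m)%:Z y = 0.
  by rewrite componentB (component_id (P_grading m) (component_deg _ _ _)) subrr.
suff -> : g y = 0 by rewrite add0r.
have [s _ yE] := component_sum_all (P_grading m) y.
rewrite yE (big_morph g gD gz) big1 // => i _.
have [im|] := Order.TotalTheory.ltP i (dl m)%:Z; first by rewrite component_low ?gz.
rewrite Order.POrderTheory.le_eqVlt => /orP[/eqP <-|mi]; first by rewrite yc gz.
have [t it] : exists t, i = (dl m)%:Z + t.+1%:Z.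
  by exists (`|i - (dl m)%:Z|%N).-1; lia.
have [N [v [b [vV gb]]]] :=
  deg_gen mn (component_deg (P_grading m) ((dl m)%:Z + t.+1%:Z) y).
rewrite it => ->; rewrite (big_morph g gD gz) big1 // => k _.
exact: g0 (vV k) (gb k).
Qed.

Lemma to_L0_top m (f : {linear P m -> L0}) x : (m <= n)%N ->
  f x = f (cmp m (dl m)%:Z x).
Proof.
move=> mn; apply: top_factor => // [y z|t v b _ gb]; first exact: linearD.
by rewrite linearZ; apply: (L0_rad piP qP); apply: gr_rad gb.
Qed.

Lemma to_L0_d m (f : {linear P m -> L0}) x : (m <= n)%N -> f (res_d P m x) = 0.
Proof. by move=> mn; rewrite to_L0_top // cmp_top_d // linear0. Qed.

Lemma head_exists (z : L0) : exists2 a, gr 0 a & q a = z.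
Proof.
case: (qP) => /(_ z)[b <-] q0; have [[|N] [c [cg ->]]] := algebra_decomp piP b.
  by exists 0; [apply: gr0|rewrite big_ord0].
exists (c 0%N) => //; rewrite big_ord_recl /= linearD [X in _ = _ + X](_ : _ = 0) ?addr0 //.
by apply/q0; exists N, (fun i => c i.+1).
Qed.

Lemma eps_exists : exists eps, V 0 eps /\ res_aug P eps = q 1.
Proof.
have [p pE] := res_aug_surj P (q 1); exists (cmp 0 (dl 0)%:Z p).
by split; [apply: component_deg|rewrite -to_L0_top].
Qed.
Definition eps := sval (cid eps_exists).
Lemma epsV : V 0 eps. Proof. by case: (svalP (cid eps_exists)). Qed.
Lemma aug_eps a : res_aug P (eps ** a) = q a.
Proof.
rewrite linearZ /=; have [_ ->] := svalP (cid eps_exists).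
by rewrite -qM mul1r.
Qed.

Lemma V0E x a : V 0 x -> gr 0 a -> res_aug P x = q a -> x = eps ** a.
Proof.
move=> Vx ga xa; apply/eqP; rewrite -subr_eq0; apply/eqP.
apply: bd_inj => //=; last by rewrite linearB aug_eps xa subrr.
by apply: (degB (P_grading 0)) => //; have := deg_act (P_grading 0) epsV ga; rewrite addr0.
Qed.

Lemma eps_gen p : exists a, p = eps ** a.
Proof.
have [N [v [a [vV _ ->]]]] := P_gen (leq0n n) p.
apply: (big_ind (fun p => exists a, p = eps ** a)) => [|_ _ [b ->] [c ->]|k _].
- by exists 0; rewrite scale0r.
- by exists (b + c); rewrite scalerDl.
have [b gb qb] := head_exists (res_aug P (v k)).
by exists (b * a k); rewrite ractM -(V0E (vV k) gb).
Qed.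

(* Split a |-> eps ** a by h and put e := h eps: then e a = 0 and 1 - e is    *)
(* nilpotent.                                                                 *)
Lemma eps_inj a : eps ** a = 0 -> a = 0.
Proof.
move=> ea; have gL : linear (fun a : (L^c)^o => eps ** (a : L)).
  by move=> b x y; rewrite scalerDl scalerA.
have [|h hE] := @res_projective _ _ P 0 _ _ (mk_linear gL) (idfun : {linear P 0 -> P 0}).
  by move=> y; have [b ->] := eps_gen y; exists b.
pose e : L := h eps; have ee : eps ** e = eps := hE eps.
have ra : rad (1 - e).
  case: (qP) => _ q0; apply/q0; rewrite linearB; apply/eqP; rewrite subr_eq0.
  by rewrite -(aug_eps e) ee -(aug_eps 1) [X in res_aug P X == _]scale1r.
have ha : e * a = 0.
  have : h (eps ** a) = 0 by rewrite ea linear0.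
  by rewrite linearZ.
have [N /(_ _ ra) rN] := rad_nilpotent I_adm piP.
suff aE k : (1 - e) ^+ k * a = a by rewrite -(aE N) rN mul0r.
elim: k => [|k IH]; first by rewrite mul1r.
by rewrite exprSr -mulrA mulrBl mul1r ha subr0.
Qed.

(** * Finite dimensionality, coordinates and dual bases of the tops *)

Lemma spanned_top m (s : seq (kmod (P m))) : (forall x, spanned s x) ->
  exists2 s' : seq (kmod (P m)), {in s', forall u, V m u} &
    forall x, V m x -> spanned s' x.
Proof.
move=> sP; exists [seq cmp m (dl m)%:Z x | x <- s].
  by move=> _ /mapP[x _ ->]; apply: component_deg.
move=> x Vx; rewrite -(component_id (P_grading m) Vx); move: (sP x).
set s' : seq (kmod (P m)) := map _ _; have s'P := spanned_subspace s'.
pose W (x : kmod (P m)) := spanned s' (cmp m (dl m)%:Z x).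
apply: (@spanned_min _ _ W) => [|u us]; last exact/spanned_mem/map_f.
split=> [|k u v Wu Wv]; first by rewrite /W component0; case: s'P.
by rewrite /W componentD cmp_kact; apply: s'P.2.
Qed.

Lemma spanned_gen m (s : seq (kmod (P m))) : (m <= n)%N ->
  (forall x, V m x -> spanned s x) ->
  exists s' : seq (kmod (P m)), forall x, spanned s' x.
Proof.
move=> mn sP; have [N [b bP]] := L_fd.
pose s' : seq (kmod (P m)) := [seq (x : P m) ** b j | x <- s, j <- enum 'I_N].
exists s' => p; have s'P := spanned_subspace s'.
have [M [v [a [vV _ ->]]]] := P_gen mn p; apply: (subspace_sum (W := spanned s')) => // k.
move: (sP _ (vV k)); pose W (x : kmod (P m)) := spanned s' ((x : P m) ** a k).
apply: (@spanned_min _ _ W) => [|u us].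
  split=> [|l u w Wu Ww]; first by rewrite /W scaler0; case: s'P.
  by rewrite /W scalerDr -kact_ract; apply: s'P.2.
rewrite /W; have [c ->] := bP (a k); rewrite scaler_suml.
apply: (subspace_sum (W := spanned s')) => // j.
rewrite ractM -[_ ** kscalar _]/(kact _ _) -kact_ract.
apply: (@subspaceZ _ _ (spanned s')) => //; apply: spanned_mem.
by apply: (allpairs_f (fun (x : P m) j => x ** b j)) => //; rewrite mem_enum.
Qed.

(** P^0 = eps L is finite dimensional because L is. The top of P^(m+1) embeds by the differential
    into P^m, and a finite dimensional top generates a finite dimensional module ([spanned_gen]). *)
Lemma P_spanned m : (m <= n)%N -> exists s : seq (kmod (P m)), forall x, spanned s x.
Proof.
elim: m => [|m IH] mn.
  have [N [b bP]] := L_fd; exists [seq eps ** b j | j <- enum 'I_N] => p.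
  have [a ->] := eps_gen p; have [c ->] := bP a.
  set s' : seq (kmod (P 0)) := map _ _; have s'P := spanned_subspace s'; rewrite scaler_suml.
  apply: (subspace_sum (W := spanned s')) => // j.
  rewrite kscalarC ractM; apply: (@subspaceZ _ _ (spanned s') (c j)) => //.
  by apply: spanned_mem; apply: map_f; rewrite mem_enum.
have [s sP] := IH (ltnW mn).
have [t tI tP] := subspace_spanned (kmod_subspace_im (res_d P m)) (fun x _ => sP x).
have ex u : exists x, u \in t -> res_d P m x = u.
  have [/tI[x <-]|nu] := boolP (u \in t); first by exists x.
  by exists 0.
pose pre u : kmod (P m.+1) := sval (cid (ex u)).
have preE u : u \in t -> res_d P m (pre u) = u := svalP (cid (ex u)).
apply: (@spanned_gen m.+1 [seq cmp m.+1 (dl m.+1)%:Z (pre u) | u <- t]) => // x Vx.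
set s' : seq (kmod (P m.+1)) := map _ _; have s'P := spanned_subspace s'.
(* The choice of the preimage is harmless: two of them differ by a cycle, whose top component is
   zero. *)
pose W (u : kmod (P m)) := exists2 y : P m.+1, res_d P m y = u &
  spanned s' (cmp m.+1 (dl m.+1)%:Z y).
have : W (res_d P m x).
  apply: (@spanned_min _ _ W t); last by apply: tP; exists x.
    split=> [|k _ _ [y <- ys] [z <- zs]].
      by exists 0; rewrite ?linear0 // component0; case: s'P.
    exists (kact k y + z); first by rewrite linearD linear_kact.
    by rewrite componentD cmp_kact; apply: s'P.2.
  by move=> u ut; exists (pre u); [apply: preE|apply/spanned_mem/map_f].
case=> y /esym/eqP; rewrite -subr_eq0 -linearB => /eqP/(@cmp_top_ker m.+1 _ mn)/eqP.
by rewrite componentB (component_id _ Vx) subr_eq0 => /eqP <-.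
Qed.

Lemma coordinates m : (m <= n)%N ->
  exists N (u : 'I_N -> P m) (phi : 'I_N -> P m -> K),
  [/\ forall i, V m (u i), forall i, {morph phi i : x y / x + y},
      forall i k x, phi i (x ** kscalar k) = k * phi i x,
      forall i x, cmp m (dl m)%:Z x = 0 -> phi i x = 0 &
      forall x, cmp m (dl m)%:Z x = \sum_i u i ** kscalar (phi i x)].
Proof.
move=> mn; have [s0 /spanned_top[s sV sP]] := P_spanned mn.
pose W (x : kmod (P m)) := cmp m (dl m)%:Z x = 0.
have WP : subspace W.
  split=> [|k x y Wx Wy]; first exact: component0.
  by rewrite /W componentD cmp_kact Wx Wy kact0 addr0.
have [|N [u [phi [us phiL phi0 uP]]]] := @coordinates_modulo _ _ W s WP.
  move=> x; exists (cmp m (dl m)%:Z x); first by apply/sP; apply: component_deg.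
  by rewrite /W componentB (component_id (P_grading m) (component_deg _ _ _)) subrr.
exists N, u, phi; split=> // [i|i x y|i k x|x].
- exact/sV/us.
- by have := phiL i 1 x y; rewrite scale1r mul1r.
- have := phiL i k x 0; rewrite addr0 => ->; rewrite (phi0 i 0) ?addr0 //.
  exact: WP.1.
have /eqP := uP x; rewrite componentB subr_eq0 => /eqP ->.
rewrite component_sum; apply: eq_bigr => i _.
by rewrite cmp_kact (component_id _ (sV _ (us i))).
Qed.

(* A K-linear functional on the top of P^m becomes a module map into L0 by    *)
(* spreading its values over the vertices.                                    *)
Section Hat.
Variables (m : nat) (phi : P m -> K) (c : L0).
Hypotheses (mn : (m <= n)%N) (phiD : {morph phi : x y / x + y}).
Hypothesis phiZ : forall k x, phi (x ** kscalar k) = k * phi x.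
Hypothesis phi0 : forall x, cmp m (dl m)%:Z x = 0 -> phi x = 0.

Fact hat_linear : linear (fun x => \sum_v (c ** idem v) ** kscalar (phi (x ** idem v))).
Proof.
have p0 : phi 0 = 0 by apply: phi0; apply: component0.
apply: (linear_to_L0 piP qP) => [x y|k x|v x|t a x ga].
- rewrite -big_split; apply: eq_bigr => v _.
  by rewrite scalerDr phiD kscalarD scalerDl.
- rewrite scaler_sumr; apply: eq_bigr => v _.
  have -> : x ** kscalar k ** idem v = x ** idem v ** kscalar k.
    by rewrite -!ractM kscalarC.
  by rewrite phiZ mulrC kscalarM ractM.
- have kscE (z : L0) k w : z ** idem w ** kscalar k = z ** kscalar k ** idem w.
    by rewrite -!ractM kscalarC.
  rewrite scaler_sumr (bigD1 v) //= [RHS](bigD1 v) //= !big1 ?addr0.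
  + by rewrite -kscE !(act_idemM pi) eqxx.
  + by move=> w wv; rewrite -kscE (act_idemM pi) (negbTE wv) scaler0.
  by move=> w wv; rewrite (act_idemM pi) eq_sym (negbTE wv) p0 kscalar0 scale0r.
rewrite big1 // => v _; rewrite -(ractM x) phi0 ?kscalar0 ?scale0r //.
apply: (@cmp_act_gr _ t) => //; rewrite -[t.+1]addn0; exact: grM ga (gr_idem _ _).
Qed.
Definition hat := mk_linear hat_linear.
End Hat.

(** [sg i x] is a representative in degree 0 of L of the value [y i x]; with it the expansion on the
    top can be written inside P^m. *)
Definition dual_basis m N (u : 'I_N -> P m) (y : 'I_N -> {linear P m -> L0})
    (sg : 'I_N -> P m -> L) :=
  [/\ forall i, V m (u i), forall i x, gr 0 (sg i x),
      forall i x, q (sg i x) = y i x &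
      forall x, V m x -> x = \sum_i u i ** sg i x].

Lemma dual_basis_exists m : (m <= n)%N -> exists N u y sg, @dual_basis m N u y sg.
Proof.
move=> mn; have [N [u [phi [uV phiD phiZ phi0 uE]]]] := coordinates mn.
exists N, u, (fun i => hat (q 1) mn (phiD i) (phiZ i) (phi0 i)).
(* The basis [u] need not respect the vertices, so the coefficients are assembled from the pieces x
   e_v, on which e_v acts as the identity. *)
exists (fun i x => \sum_v idem v * kscalar (phi i (x ** idem v))).
split=> // [i x|i x|x Vx].
- apply: gr_sum => v _; rewrite -[0%N]addn0; apply: grM.
    exact: gr_idem.
  exact: (gr_scalar piP).
- rewrite linear_sum /=; apply: eq_bigr => v _.
  by rewrite -qM mul1r -qM.
have xe v : V m (x ** idem v).
  by have := deg_act (P_grading m) Vx (gr_idem pi v); rewrite addr0.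
rewrite {1}(sum_act_idem pi x).
under [RHS]eq_bigr => i _ do rewrite scaler_suml.
rewrite exchange_big /=; apply: eq_bigr => v _.
under eq_bigr => i _ do rewrite -kscalarC ractM.
rewrite -scaler_sumr -uE (component_id _ (xe v)).
by rewrite (act_idemM pi) eqxx.
Qed.

Section DualBasis.
Variables (m N : nat) (u : 'I_N -> P m) (y : 'I_N -> {linear P m -> L0}).
Variables (sg : 'I_N -> P m -> L) (h : 'I_N -> {linear P m -> P 0}).
Hypotheses (mn : (m <= n)%N) (db : dual_basis u y sg).
Hypothesis hE : forall i x, res_aug P (h i x) = y i x.

Lemma lift_top i x : cmp 0 0 (h i x) = eps ** sg i x.
Proof.
case: db => _ sg0 sgE _; apply: V0E => //.
  by rewrite dl0; apply: component_deg.
by have := to_L0_top (res_aug P) (h i x) (leq0n n); rewrite dl0 => <-; rewrite hE sgE.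
Qed.

(** [h i] need not be homogeneous, but after acting by degree t only the degree 0 component of
    [h i (x k)] reaches degree t, and [lift_top] computes it. *)
Lemma lift_component J (r : seq J) (x : J -> P m) (b : J -> L) t i :
  (forall k, gr t (b k)) ->
  cmp 0 t%:Z (h i (\sum_(k <- r) x k ** b k)) =
    eps ** (\sum_(k <- r) sg i (x k) * b k).
Proof.
move=> gb; rewrite linear_sum component_sum scaler_suml; apply: eq_bigr => k _.
by rewrite linearZ /= (component_act _ _ _ (gb k)) subrr lift_top -ractM.
Qed.

Lemma dual_basis_expand J (r : seq J) (x : J -> P m) (b : J -> L) :
  (forall k, V m (x k)) ->
  \sum_(k <- r) x k ** b k = \sum_i u i ** (\sum_(k <- r) sg i (x k) * b k).
Proof.
move=> xV; case: db => _ _ _ uE.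
under [RHS]eq_bigr => i _ do rewrite scaler_suml.
rewrite exchange_big /=; apply: eq_bigr => k _.
rewrite {1}(uE _ (xV k)) scaler_sumr; apply: eq_bigr => i _.
by rewrite -ractM.
Qed.

(** The last clause is the point: with [eps_inj], a homogeneous x vanishes as soon as the relevant
    components of all [h i x] do. *)
Lemma homogeneous_coords t x : deg m ((dl m)%:Z + t%:Z) x -> exists mu : 'I_N -> L,
  [/\ forall i, gr t (mu i), x = \sum_i u i ** mu i &
      forall i, cmp 0 t%:Z (h i x) = eps ** mu i].
Proof.
move=> /(deg_gen mn)[M [v [b [vV gb ->]]]].
exists (fun i => \sum_k sg i (v k) * b k); split=> [i||i].
- by apply: gr_sum => k _; have [_ sg0 _ _] := db; apply: grM (sg0 i (v k)) (gb k).
- exact: dual_basis_expand.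
exact: lift_component.
Qed.

End DualBasis.

Lemma aug_lifts m N (y : 'I_N -> {linear P m -> L0}) :
  exists h : 'I_N -> {linear P m -> P 0}, forall i x, res_aug P (h i x) = y i x.
Proof.
exists (fun i => sval (cid (aug_lift (y i)))) => i.
exact: svalP (cid (aug_lift (y i))).
Qed.

(** Terms are collected along distinct paths, with coefficients supported at their sources, to match
    the hypotheses of [P1_right_free]. *)
Lemma deg_gen_paths m s x : (m <= n)%N -> deg m ((dl m)%:Z + s%:Z) x ->
  exists (l : seq (qpath Q)) (w : qpath Q -> P m),
  [/\ uniq l, {in l, forall p, qlength p = s}, forall p, V m (w p),
      forall p, w p ** idem (qsource p) = w p &
      x = \sum_(p <- l) w p ** pi (path_elt K p)].
Proof.
move=> mn /(deg_gen mn)[M [v [b [vV gb ->]]]].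
apply: (big_ind (fun x => exists (l : seq (qpath Q)) (w : qpath Q -> P m),
  [/\ uniq l, {in l, forall p, qlength p = s}, forall p, V m (w p),
      forall p, w p ** idem (qsource p) = w p &
      x = \sum_(p <- l) w p ** pi (path_elt K p)])).
- exists [::], (fun=> 0); split=> // [p|p|]; first exact: (deg0 (P_grading m)).
    by rewrite scaler0.
  by rewrite big_nil.
- move=> _ _ [l [w [lu ls wV we ->]]] [l' [w' [lu' ls' wV' we' ->]]].
  exists (undup (l ++ l')).
  exists (fun p => (if p \in l then w p else 0) + (if p \in l' then w' p else 0)).
  have extend (l1 l2 : seq (qpath Q)) (w1 : qpath Q -> P m) : uniq l1 -> uniq l2 ->
      {subset l1 <= l2} -> \sum_(p <- l1) w1 p ** pi (path_elt K p) =
      \sum_(p <- l2) (if p \in l1 then w1 p else 0) ** pi (path_elt K p).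
    move=> l1u l2u l12; rewrite [RHS](bigID (mem l1)) /= [X in _ = _ + X]big1.
      rewrite addr0 -[RHS]big_filter [RHS](perm_big l1).
        by apply: eq_big_seq => p ->.
      apply: uniq_perm; rewrite ?filter_uniq // => p.
      by rewrite mem_filter; case: (boolP (p \in l1)) => //= /l12.
    by move=> p /negbTE ->; rewrite scaler0.
  split=> [|p|p|p|]; first exact: undup_uniq.
  + by rewrite mem_undup mem_cat => /orP[/ls|/ls'].
  + by apply: (degD (P_grading m)); case: ifP => // _; apply: (deg0 (P_grading m)).
  + by rewrite scalerDr; congr (_ + _); case: ifP; rewrite ?scaler0.
  under [RHS]eq_bigr => p _ do rewrite scalerDr.
  rewrite big_split; congr (_ + _); apply: extend; rewrite ?undup_uniq // => p pl;
    by rewrite mem_undup mem_cat pl ?orbT.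
move=> k _; have [l [c [lu ls ->]]] := homogeneous_sum_paths piP (gb k).
exists l, (fun p => (v k ** kscalar (c p)) ** idem (qsource p)); split=> // [p|p|].
- rewrite -ractM; have := deg_act (P_grading m) (vV k)
    (grM (gr_scalar piP (c p)) (gr_idem pi (qsource p))).
  by rewrite addr0.
- by rewrite (act_idemM pi) eqxx.
rewrite scaler_suml; apply: eq_bigr => p _.
by rewrite ractM -[RHS]ractM -rmorphM path_elt_idem.
Qed.

(** * Relations of length less than D, and right freeness of P^1 in low degrees *)

Section ShortRelations.
Variable D : nat.
Hypotheses (n2 : (2 <= n)%N) (dl1 : dl 1%N = 1%N) (dl2 : dl 2%N = D).

Lemma gr1_lift a : gr 1 a -> exists2 g, V 1 g & res_d P 0 g = eps ** a.
Proof.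
move=> ga; have /res_exact0[x xE] : res_aug P (eps ** a) = 0.
  by rewrite aug_eps; case: (qP) => _ q0; apply/q0; apply: gr_rad ga.
exists (cmp 1 (dl 1)%:Z x); first exact: component_deg.
rewrite -cmp_d xE component_id // dl1.
by have := deg_act (P_grading 0) epsV ga; rewrite dl0 add0r.
Qed.

Lemma d_V1 g : V 1 g -> exists2 a, gr 1 a & res_d P 0 g = eps ** a.
Proof.
move=> Vg; have [a aE] := eps_gen (res_d P 0 g).
have [b gb bE] := gen_component 1 a epsV; exists b => //.
rewrite -bE -aE component_id // dl0 add0r.
by have := d_deg Vg; rewrite dl1.
Qed.

(* A relation z = sum A_p B_p with A_p of length 1 lifts to the cycle          *)
(* sum g_p B_p of P^1, where d g_p = A_p; it vanishes because P^2 starts in    *)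
(* degree D.  Its coordinates are shorter relations, zero by induction, and    *)
(* z is a left linear combination of them.                                     *)
Lemma no_short_relation j z : (j < D)%N -> length_homogeneous j z ->
  pi z = 0 -> z = 0.
Proof.
elim: j z => [|j IH] z jD zj z0; first exact: (pi_low I_adm piP _ zj).
have n1 : (1 <= n)%N by apply: leq_trans n2.
have [N [u [y [sg db]]]] := dual_basis_exists n1.
have [h hE] := aug_lifts y.
have [l [A [B [A1 Bj zE]]]] := homogeneous_decomp zj.
have gA p : gr 1 (pi (A p)) by exists (A p).
have gB p : gr j (pi (B p)) by exists (B p).
pose g p := sval (cid2 (gr1_lift (gA p))).
have gV p : V 1 (g p) by case: (svalP (cid2 (gr1_lift (gA p)))).
have gd p : res_d P 0 (g p) = eps ** pi (A p).
  by case: (svalP (cid2 (gr1_lift (gA p)))).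
pose w := \sum_(p <- l) g p ** pi (B p).
have w0 : w = 0.
  have wd : deg 1 (1 + j%:Z) w.
    apply: (deg_sum (P_grading 1)) => p _.
    by have := deg_act (P_grading 1) (gV p) (gB p); rewrite dl1.
  have : res_d P 0 w = 0.
    rewrite linear_sum -[RHS](scale0r eps).
    have <- : pi z = 0 :> L^c by [].
    rewrite zE rmorph_sum scaler_suml; apply: eq_bigr => p _.
    by rewrite linearZ /= gd rmorphM ractM.
  move/res_exact => -[x xE]; rewrite -(component_id (P_grading 1) wd) -xE cmp_d.
  by rewrite component_low ?linear0 // dl2; lia.
have sg0 i p : gr 0 (sg i (g p)) by case: db.
pose s i p := sval (cid2 (sg0 i p)).
have sH i p : length_homogeneous 0 (s i p) by case: (svalP (cid2 (sg0 i p))).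
have sE i p : sg i (g p) = pi (s i p) by case: (svalP (cid2 (sg0 i p))).
have zi i : \sum_(p <- l) s i p * B p = 0.
  apply: IH; first exact: ltnW.
    apply: homogeneous_sum => p _; exact: homogeneousM (sH i p) (Bj p).
  rewrite rmorph_sum; apply: eps_inj.
  have := lift_component db hE l g i gB; rewrite -/w w0 linear0 component0 => ->.
  by congr (_ *: _); apply: eq_bigr => p _; rewrite rmorphM sE.
have uV i : V 1 (u i) by case: db.
pose a i := sval (cid2 (d_V1 (uV i))).
have ga i : gr 1 (a i) by case: (svalP (cid2 (d_V1 (uV i)))).
have aE i : res_d P 0 (u i) = eps ** a i by case: (svalP (cid2 (d_V1 (uV i)))).
pose r i := sval (cid2 (ga i)).
have rH i : length_homogeneous 1 (r i) by case: (svalP (cid2 (ga i))).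
have rE i : a i = pi (r i) by case: (svalP (cid2 (ga i))).
(* Both sides have length 1, where [pi] is injective; in L the equality is the image under d of the
   expansion of [g p] in the dual basis. *)
have AE p : A p = \sum_i r i * s i p.
  apply/eqP; rewrite -subr_eq0; apply/eqP/(pi_low I_adm piP (ltnSn 1)).
    apply: homogeneousD => //; apply: homogeneousN; apply: homogeneous_sum => i _.
    by rewrite -[1%N]addn0; apply: homogeneousM.
  rewrite rmorphB; apply/eqP; rewrite subr_eq0; apply/eqP.
  apply/eqP; rewrite -subr_eq0; apply/eqP/eps_inj; rewrite scalerBl -gd.
  case: db => _ _ _ /(_ _ (gV p)) gE; rewrite {1}gE linear_sum rmorph_sum scaler_suml.
  rewrite -sumrB big1 // => i _.
  by rewrite linearZ /= aE sE rE rmorphM ractM subrr.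
rewrite zE; under eq_bigr => p _ do rewrite AE mulr_suml.
rewrite exchange_big big1 // => i _.
under eq_bigr => p _ do rewrite -mulrA.
by rewrite -mulr_sumr zi mulr0.
Qed.

(** The i-th coordinates of the [g p] lift to path algebra elements of length t. Applying [h i] to
    the relation gives an element of I of length t + s < D, which is zero in KQ, so that
    [right_path_free] applies there. *)
Lemma P1_right_free (l : seq (qpath Q)) (g : qpath Q -> P 1) t s :
  (t + s < D)%N -> uniq l -> {in l, forall p, qlength p = s} ->
  (forall p, deg 1 (1 + t%:Z) (g p)) ->
  (forall p, g p ** idem (qsource p) = g p) ->
  \sum_(p <- l) g p ** pi (path_elt K p) = 0 -> {in l, forall p, g p = 0}.
Proof.
move=> tsD lu ls gd ge g0.
have n1 : (1 <= n)%N by apply: leq_trans n2.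
have [N [u [y [sg db]]]] := dual_basis_exists n1.
have [h hE] := aug_lifts y.
have gd' p : deg 1 ((dl 1)%:Z + t%:Z) (g p) by rewrite dl1.
pose mu p := sval (cid (homogeneous_coords n1 db hE (gd' p))).
have muP p := svalP (cid (homogeneous_coords n1 db hE (gd' p))).
have gmu p i : gr t (mu p i) by have [mug _ _] := muP p; apply: mug.
pose m p i := sval (cid2 (gmu p i)).
have mH p i : length_homogeneous t (m p i) by case: (svalP (cid2 (gmu p i))).
have mE p i : mu p i = pi (m p i) by case: (svalP (cid2 (gmu p i))).
have m0 i : {in l, forall p, m p i * vertex_idem K (qsource p) = 0}.
  apply: (right_path_free lu ls) => [p _|].
    by rewrite -mulrA idemM eqxx.
  apply: (no_short_relation tsD).
    rewrite big_seq; apply: homogeneous_sum => p pl; apply: homogeneousM.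
      by rewrite -[t]addn0; apply: homogeneousM; last exact: homogeneous_idem.
    by rewrite -(ls p pl); apply: homogeneousU.
  apply: eps_inj; rewrite rmorph_sum scaler_suml.
  have := congr1 (cmp 0 (t + s)%N%:Z) (congr1 (h i) g0).
  rewrite linear0 component0 linear_sum component_sum => g0'.
  rewrite -[RHS]g0' !big_seq; apply: eq_bigr => p pl.
  have gp : gr s (pi (path_elt K p)).
    by exists (path_elt K p) => //; rewrite -(ls p pl); apply: homogeneousU.
  rewrite linearZ /= (component_act _ _ _ gp) PoszD addrK.
  have [_ _ ->] := muP p; rewrite -ractM -/(mu p i) mE -rmorphM.
  by rewrite -mulrA path_elt_idem.
move=> p pl; have [_ gE _] := muP p; rewrite -ge gE scaler_sumr big1 // => i _.
by rewrite -ractM -/(mu p i) mE -rmorphM m0 // rmorph0 scale0r.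
Qed.

(** * Joint injectivity of the lifts and factorization through P^2 *)

Section Key.
Variables (b N : nat) (u : 'I_N -> P b) (y : 'I_N -> {linear P b -> L0}).
Variables (sg : 'I_N -> P b -> L) (h0 : 'I_N -> {linear P b -> P 0}).
Variables (h1 : 'I_N -> {linear P b.+1 -> P 1}) (h2 : 'I_N -> {linear P b.+2 -> P 2}).
Hypotheses (bn : (b.+2 <= n)%N) (dlb : dl b.+2 = (dl b + D)%N).
Hypothesis db : dual_basis u y sg.
Hypothesis h0E : forall i x, res_aug P (h0 i x) = y i x.
Hypothesis h1E : forall i x, res_d P 0 (h1 i x) = h0 i (res_d P b x).
Hypothesis h2E : forall i x, res_d P 1 (h2 i x) = h1 i (res_d P b.+1 x).

Lemma lifts_inj_top x : V b.+2 x -> (forall i, cmp 2 D%:Z (h2 i x) = 0) -> x = 0.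
Proof.
move=> Vx x0; have b1n : (b.+1 <= n)%N := ltnW bn.
have bn' : (b <= n)%N := ltnW b1n.
have n1 : (1 <= n)%N by apply: leq_trans n2.
apply: (@bd_inj b.+2 _ bn Vx); rewrite -[LHS]/(res_d P b.+1 x).
set w := res_d P b.+1 x; have wd : deg b.+1 (dl b.+2)%:Z w by apply: d_deg.
have w1 i : cmp 1 D%:Z (h1 i w) = 0 by rewrite -h2E cmp_d x0 linear0.
(* [dl] is not assumed monotone; if it drops here, w lies below the generators of P^(b+1) and is
   zero. *)
case: (ltnP (dl b.+2) (dl b.+1)) => [lt|le]; first by apply: (deg_low b1n wd).
pose s := (dl b.+2 - dl b.+1)%N.
have wd' : deg b.+1 ((dl b.+1)%:Z + s%:Z) w by rewrite -PoszD subnKC.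
have [l [v [lu ls vV ve wE]]] := deg_gen_paths b1n wd'.
(* The degree of P^1 from which a path of length s leads to degree D. It may be nonpositive; by
   [dlb] it equals dl (b+1) - dl b. *)
pose t : int := D%:Z - s%:Z.
have gp p : p \in l -> gr s (pi (path_elt K p)).
  by move=> pl; exists (path_elt K p) => //; rewrite -(ls p pl); apply: homogeneousU.
have h1t i : {in l, forall p, cmp 1 t (h1 i (v p)) = 0}.
  (* If s >= D then t <= 0 is below the generating degree 1 of P^1; otherwise (t - 1) + s = D - 1 is
     within reach of [P1_right_free]. *)
  case: (ltnP s D) => sD; last first.
    by move=> p _; apply: component_low => //; rewrite dl1 /t; lia.
  have [t' tE] : exists t', t = 1 + t'%:Z by exists (D - s).-1; rewrite /t; lia.
  apply: (@P1_right_free l (fun p => cmp 1 t (h1 i (v p))) t' s) => // [|p|p|].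
  - by move: tE; rewrite /t; lia.
  - by rewrite -tE; apply: component_deg.
  - have := component_act (P_grading 1) t (h1 i (v p)) (gr_idem pi (qsource p)).
    by rewrite subr0 -linearZ /= ve => <-.
  rewrite -[RHS](w1 i) wE linear_sum component_sum !big_seq; apply: eq_bigr => p pl.
  by rewrite linearZ /= (component_act _ _ _ (gp p pl)).
rewrite wE big_seq big1 // => p pl; rewrite [v p](_ : _ = 0) ?scaler0 //.
apply: (@bd_inj b.+1 _ b1n (vV p)); rewrite -[LHS]/(res_d P b (v p)).
have zd : deg b (dl b.+1)%:Z (res_d P b (v p)) by apply: d_deg; apply: vV.
have z0 i : cmp 0 t (h0 i (res_d P b (v p))) = 0.
  by rewrite -h1E cmp_d h1t // linear0.
case: (ltnP (dl b.+1) (dl b)) => [lt|le']; first by apply: (deg_low bn' zd).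
have tE : t = (dl b.+1 - dl b)%N by rewrite /t /s; lia.
have zd' : deg b ((dl b)%:Z + (dl b.+1 - dl b)%N%:Z) (res_d P b (v p)).
  by rewrite -PoszD subnKC.
have [mu [_ muS muE]] := homogeneous_coords bn' db h0E zd'.
rewrite muS big1 // => i _; rewrite (_ : mu i = 0) ?scale0r //.
by apply: eps_inj; rewrite -muE -tE z0.
Qed.

(** Reduction to the top: by [top_factor] the degree D component of [h2 i x] sees only the top
    component of x. *)
Lemma lifts_inj x : (forall i, cmp 2 D%:Z (h2 i x) = 0) ->
  cmp b.+2 (dl b.+2)%:Z x = 0.
Proof.
move=> x0; apply: lifts_inj_top => [|i]; first exact: component_deg.
rewrite -[RHS](x0 i); apply/esym.
apply: (@top_factor b.+2 _ (fun x => cmp 2 D%:Z (h2 i x))) => // [z z'|t v a _ ga].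
  by rewrite linearD componentD.
by rewrite linearZ /= -dl2; apply: cmp_act_gr ga.
Qed.

Lemma sum_of_products (f : {linear P b.+2 -> L0}) :
  exists x : 'I_N -> {linear P 2 -> L0}, forall p, f p = \sum_i x i (h2 i p).
Proof.
have [M [w [phi [wV phiD phiZ phi0 wE]]]] := coordinates n2.
pose psi (ij : 'I_N * 'I_M) (p : kmod (P b.+2)) := phi ij.2 (h2 ij.1 p).
have [|||c cE] := @linear_combination_of_functionals K (kmod (P b.+2)) (kmod L0) _
    psi f.
- move=> ij k p p'; rewrite /psi linearD phiD.
  by rewrite -[k *: p]/(kact k (p : P b.+2)) linear_kact phiZ.
- by move=> k p p'; rewrite linearD; congr (_ + _); apply: linear_kact.
- move=> p p0; rewrite to_L0_top // lifts_inj ?linear0 // => i.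
  rewrite -dl2 wE big1 // => j _.
  have -> : phi j (h2 i p) = 0 := p0 (i, j).
  by rewrite kscalar0; apply: scale0r.
pose X i j := hat (c (i, j)) n2 (phiD j) (phiZ j) (phi0 j).
have XL i : linear (fun z => \sum_j X i j z).
  move=> a z z'; rewrite scaler_sumr -big_split /=.
  by apply: eq_bigr => j _; apply: (linearP (X i j)).
exists (fun i => mk_linear (XL i)) => p.
(* A single term phi_j(h2_i p) c_ij is only K-linear in p; splitting by vertices replaces it by the
   module map [hat]. *)
rewrite [LHS](sum_act_idem pi).
transitivity (\sum_i \sum_j \sum_v
    (c (i, j) ** idem v) ** kscalar (phi j (h2 i p ** idem v))).
  rewrite pair_big /= exchange_big /=; apply: eq_bigr => v _.
  have -> : f p ** idem v = f (p ** idem v) ** idem v.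
    by rewrite linearZ /= (act_idemM pi) eqxx.
  rewrite cE scaler_sumr; apply: eq_bigr => -[i j] _ /=.
  rewrite /psi /= linearZ /=.
  exact: (esym (kact_ract _ (c (i, j)) (idem v))).
by [].
Qed.

End Key.

End ShortRelations.

End MinimalResolution.

(** * Comparison of resolutions and homogeneous classes *)

Section ChainMaps.
Variables (K : fieldType) (L : pzAlgType K) (M : rmodType L).
Variables (X : nat -> rmodType L) (dX : forall j, {linear X j.+1 -> X j}).
Hypothesis X_proj : forall j, projective (X j).
Hypothesis dXX : forall j x, dX j (dX j.+1 x) = 0.
Variable P : resolution M.

Definition chain_map (l : forall j, {linear X j -> P j}) :=
  forall j x, res_d P j (l j.+1 x) = l j (dX j x).

Lemma bd_lift j i (f : {linear X j -> P i}) : (forall x, bd P i (f x) = 0) ->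
  exists h : {linear X j -> P i.+1}, forall x, res_d P i (h x) = f x.
Proof. by move=> f0; apply: projective_lift => // x; apply: bd_exact. Qed.

(** The source is any complex of projectives, exact or not, so that it may be a resolution shifted
    by b. *)
Lemma chain_map_exists (f : {linear X 0 -> M}) : (forall x, f (dX 0 x) = 0) ->
  exists2 l, chain_map l & forall x, res_aug P (l 0 x) = f x.
Proof.
move=> fd; have [l0 l0E] : exists l0 : {linear X 0 -> P 0},
    forall x, res_aug P (l0 x) = f x.
  by apply: projective_lift => // x; apply: res_aug_surj.
pose inv j (l : {linear X j -> P j}) := forall x, bd P j (l (dX j x)) = 0.
pose rel j (l : {linear X j -> P j}) (l' : {linear X j.+1 -> P j.+1}) :=
  forall x, res_d P j (l' x) = l (dX j x).
have [||l [lE lP]] := @dependent_choice _ inv rel l0.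
- by move=> x /=; rewrite l0E fd.
- move=> j l lI; have [l' l'E] := bd_lift (f := l \o dX j) lI.
  by exists l'; split=> // x; rewrite /= l'E /= dXX linear0.
by exists l => [j|x]; [have [] := lP j|rewrite lE l0E].
Qed.

Lemma chain_homotopy (l l' : forall j, {linear X j -> P j}) :
  chain_map l -> chain_map l' ->
  (forall x, res_aug P (l 0 x) = res_aug P (l' 0 x)) ->
  exists s : forall j, {linear X j -> P j.+1},
    forall j x, l j.+1 x - l' j.+1 x = res_d P j.+1 (s j.+1 x) + s j (dX j x).
Proof.
move=> lc lc' laug.
have [|s0 s0E] := @bd_lift 0 0 (l 0 \- l' 0).
  by move=> x; rewrite /= linearB laug subrr.
pose inv j (s : {linear X j -> P j.+1}) :=
  forall x, res_d P j (l j.+1 x - l' j.+1 x - s (dX j x)) = 0.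
pose rel j (s : {linear X j -> P j.+1}) (s' : {linear X j.+1 -> P j.+2}) :=
  forall x, res_d P j.+1 (s' x) = l j.+1 x - l' j.+1 x - s (dX j x).
have [||s [sE sP]] := @dependent_choice _ inv rel s0.
- by move=> x; rewrite !linearB lc lc' s0E /= subrr.
- move=> j s sI.
  have [s' s'E] := bd_lift (f := (l j.+1 \- l' j.+1) \- (s \o dX j)) sI.
  exists s'; split=> // x; rewrite !linearB s'E lc lc' /=.
  by rewrite dXX linear0 subr0 subrr.
by exists s => j x; have [_ ->] := sP j; rewrite subrK.
Qed.

End ChainMaps.

(** * Cocycles concentrated in one degree, and their products *)

Section ExtClasses.
Variables (K : fieldType) (L : pzAlgType K) (M : rmodType L) (R : resolution M).

Lemma comparison_homotopy (T : resolution M) :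
  exists (phi : forall j, {linear R j -> T j}) (psi : forall j, {linear T j -> R j})
    (s : forall j, {linear R j -> R j.+1}),
  [/\ chain_map (res_d R) phi, forall x, res_aug T (phi 0 x) = res_aug R x &
      forall j x, x - psi j.+1 (phi j.+1 x) =
        res_d R j.+1 (s j.+1 x) + s j (res_d R j x)].
Proof.
have dR (S : resolution M) x : res_aug S (res_d S 0 x) = 0 by apply: (@bd_d _ _ _ S 0).
have [phi phic phiE] := chain_map_exists (@res_projective _ _ R) (@bd_d0 _ _ _ R) T
  (f := res_aug R) (dR R).
have [psi psic psiE] := chain_map_exists (@res_projective _ _ T) (@bd_d0 _ _ _ T) R
  (f := res_aug T) (dR T).
have [||x|s sE] := chain_homotopy (@res_projective _ _ R) (@bd_d0 _ _ _ R)
  (P := R) (l := fun j => idfun) (l' := fun j => psi j \o phi j).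
- by [].
- by move=> j x /=; rewrite psic phic.
- by rewrite /= psiE phiE.
by exists phi, psi, s.
Qed.

Section Single.
Variables (n : nat) (c : {linear R n -> M}).
Hypothesis cd : forall p, c (res_d R n p) = 0.

Definition single_fun m : {linear R m -> M} :=
  if @eqP _ n m is ReflectT e then ecast i {linear R i -> M} e c else \0.

Lemma single_fun_id p : single_fun n p = c p.
Proof. by rewrite /single_fun; case: eqP => // e; rewrite eq_axiomK. Qed.

Lemma single_fun_0 m p : m != n -> single_fun m p = 0.
Proof. by rewrite eq_sym /single_fun; case: eqP. Qed.

Fact single_d m p : single_fun m (res_d R m p) = 0.
Proof.
have [mn|mn] := eqVneq m n; last by rewrite single_fun_0.
by move: p; rewrite mn => p; rewrite single_fun_id.
Qed.
Fact single_fin : exists N, forall m p, (N <= m)%N -> single_fun m p = 0.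
Proof. by exists n.+1 => m p nm; rewrite single_fun_0 // gtn_eqF. Qed.
Definition single := Cocycle single_d single_fin.
End Single.

Lemma single_id n c cd p : @single n c cd n p = c p.
Proof. exact: single_fun_id. Qed.

Lemma single_0 n c cd m p : m != n -> @single n c cd m p = 0.
Proof. exact: single_fun_0. Qed.

Lemma single_cohom n (c : {linear R n.+1 -> M}) cd (c' : {linear R n.+1 -> M})
    cd' (g : {linear R n -> M}) :
  (forall p, c p - c' p = g (res_d R n p)) ->
  cohom (@single n.+1 c cd) (@single n.+1 c' cd').
Proof.
move=> gE; split=> [p|m]; first by rewrite !single_0.
have [mn|mn] := eqVneq m n; last by exists \0 => p; rewrite !single_0 ?subrr.
by subst m; exists g => p; rewrite !single_id.
Qed.

Lemma single_mul b (x : {linear R 2 -> M}) xd (y : {linear R b -> M}) yd :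
  exists (l : forall j, {linear R (j + b) -> R j}),
  [/\ chain_map (fun j => res_d R (j + b)) l,
      forall p, res_aug R (l 0 p) = y p &
      forall (c : {linear R b.+2 -> M}) cd, (forall p, c p = x (l 2 p)) ->
        ext_class (@single b.+2 c cd) =
        ext_class (single (c := x) xd) * ext_class (single (c := y) yd)].
Proof.
have [l [la lc l0 [N lN]]] := lift_exists (single yd).
exists (fun j => l j (j + b)%N); split=> [j p|p|c cd cE]; first exact: lc.
  by rewrite la single_id.
(* A lift of [single yd] may have components off the diagonal j = i + b; discarding them leaves a
   lift of the same cocycle. *)
pose l' i j : {linear R j -> R i} := if j == (i + b)%N then l i j else \0.
have l'P : is_lift (single yd) l'.
  rewrite /l'; split=> [j p|i j p|i j p ji|].
  - case: eqP => [_|/eqP nj]; first exact: la.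
    by rewrite single_0 ?linear0.
  - by rewrite addSn eqSS; case: eqP => _; [apply: lc|rewrite linear0].
  - by case: eqP => // _; apply: l0.
  by exists N => i j p ij; case: eqP => // _; apply: lN.
rewrite -[RHS]/(ext_mul _ _) ext_mulE; apply/ext_classP.
apply: cohom_sym; apply: cohom_trans (yoneda_comp _ l'P) (cohom_eq _) => m p.
rewrite /= /comp_fun.
have [mb|mb] := eqVneq m b.+2; last first.
  rewrite -[RHS]/(single cd m p) single_0 // big1 // => i _.
  have [i2|i2] := eqVneq (i : nat) 2; last exact: (single_0 xd).
  by rewrite /l' i2 (negbTE mb) linear0.
subst m; rewrite -[RHS]/(single cd b.+2 p) single_id cE.
rewrite (bigD1 (Ordinal (isT : (2 < b.+3)%N))) //= big1 ?addr0 => [|i i2].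
  by rewrite -[LHS]/(single xd 2 _) single_id /l' eqxx.
exact: (single_0 xd).
Qed.

Variable S : ext R -> Prop.
Hypothesis SP : subalgebra S.

Lemma subalgebra_zero (x : cocycle R) : (forall n p, x n p = 0) -> S (ext_class x).
Proof.
move=> x0; case: SP => /(_ 0) S0 _ _; move: S0; congr S.
apply/ext_classP/cohom_eq => n p; rewrite x0 /=.
by rewrite /kact kscalar0 scale0r.
Qed.

Lemma subalgebra_add (x y z : cocycle R) : S (ext_class x) -> S (ext_class y) ->
  (forall n p, z n p = x n p + y n p) -> S (ext_class z).
Proof.
move=> Sx Sy zE; case: SP => _ SD _; have := SD _ _ Sx Sy.
rewrite -[_ + _]/(ext_add _ _) ext_addE; congr S.
by apply/ext_classP/cohom_eq => n p; rewrite zE.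
Qed.

Lemma subalgebra_single_sum n N (F : 'I_N -> {linear R n -> M}) :
  (forall i Fd, S (ext_class (@single n (F i) Fd))) ->
  (forall i p, F i (res_d R n p) = 0) ->
  forall (c : {linear R n -> M}) cd, (forall p, c p = \sum_i F i p) ->
  S (ext_class (@single n c cd)).
Proof.
elim: N F => [|N IH] F SF Fd c cd cE.
  apply: subalgebra_zero => m p; have [mn|mn] := eqVneq m n; last exact: single_0.
  by subst m; rewrite single_id cE big_ord0.
have c'd p : (c \- F ord_max) (res_d R n p) = 0 by rewrite /= cd Fd subrr.
apply: (subalgebra_add (x := single c'd) (y := single (Fd ord_max))) => //.
  apply: (IH (fun i => F (widen_ord (leqnSn N) i))) => // p.
  by rewrite /= cE big_ord_recr addrK.
move=> m p; have [mn|mn] := eqVneq m n; last by rewrite !single_0 ?addr0.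
by subst m; rewrite !single_id /= subrK.
Qed.

(** Cocycles have finite support, so the highest degree can be peeled off repeatedly. *)
Lemma subalgebra_all :
  (forall n c cd, S (ext_class (@single n c cd))) -> forall a, S a.
Proof.
move=> Ss; elim/ext_ind => x; have [N xN] := coc_fin x.
elim: N x xN => [|N IH] x xN; first by apply: subalgebra_zero => n p; apply: xN.
have xd p : x N (res_d R N p) = 0 by apply: coc_d.
pose y := add_coc x (scale_coc (single xd) (-1)).
have yE n p : y n p = x n p - single xd n p by rewrite -[LHS]/(_ + _) /= kactN1.
apply: (subalgebra_add (x := y) (y := single xd)) => // [|n p]; last first.
  by rewrite yE subrK.
apply: IH => n p; rewrite yE leq_eqVlt => /orP[/eqP Nn|Nn].
  by subst n; rewrite single_id subrr.
by rewrite xN // single_0 ?subr0 // gtn_eqF.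
Qed.

End ExtClasses.

(** * Generation of the Ext algebra *)

Lemma delta_add2 D A b : (2 <= b)%N -> delta D A b.+2 = (delta D A b + D)%N.
Proof.
case: b => [|[|b]] // _; rewrite /delta /= !negbK.
by case: (odd b); rewrite ?mulSn; lia.
Qed.

Lemma gldim_lt (R : pzRingType) n :
  ~ le_gldim R n -> exists2 m, gldim_le R m & (m < n)%N.
Proof.
move=> ng; apply: contrapT => h; apply: ng => m mg; rewrite leqNgt.
by apply/negP => mn; apply: h; exists m.
Qed.

Theorem theorem1p4 (K : fieldType) (Q : quiver) (I : path_algebra K Q -> Prop)
    (L : pzAlgType K) (pi : {rmorphism path_algebra K Q -> L})
    (L0 : rmodType L) (q : {linear (L^c)^o -> L0}) (D A : nat) :
  admissible I -> generated_by_homogeneous I ->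
  quotient_algebra pi I -> finite_dimensional L ->
  radical_quotient (length_degree pi) q ->
  (2 <= D)%N -> (1 <= A)%N -> stacked (length_degree pi) L0 D A ->
  forall P : resolution L0,
    generates_algebra (fun a : ext P => exists2 n, (n <= 3)%N & ext_degree n a).
Proof.
move=> I_adm _ piP L_fd qP _ _ [M [deg [M_min M_gen]]] P S SP SG.
apply: (subalgebra_all SP) => n; elim/ltn_ind: n => n IH c cd.
case: (leqP n 3) => [n3|].
  apply: SG; exists n => //; exists (single cd) => // m p; exact: single_0.
case: n IH c cd => [|[|b]] // IH c cd b2; rewrite !ltnS in b2.
have [ng|/gldim_lt[m mg mb]] := pselect (le_gldim L^c b.+2); last first.
  (* Above the global dimension psi o phi is zero in degree b+2, so the homotopy writes c as a
     coboundary. *)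
  have [T T0] := mg L0; have [phi [psi [s [_ _ sE]]]] := comparison_homotopy P T.
  have z0 p : (\0 : {linear P b.+2 -> L0}) (res_d P b.+2 p) = 0 by [].
  have -> : ext_class (single cd) = ext_class (single z0).
    apply/ext_classP/(@single_cohom _ _ _ _ b.+1 _ cd _ z0 (c \o s b.+1)) => p.
    have := sE b.+1 p; rewrite (T0 _ mb (phi b.+2 p)) linear0 subr0 => {1}->.
    by rewrite linearD cd add0r subr0.
  apply: (subalgebra_zero SP) => k p.
  have [kb|kb] := eqVneq k b.+2; last exact: single_0.
  by subst k; rewrite single_id.
have gen k : (k <= b.+2)%N -> generated_in_degree (deg k) (delta D A k)%:Z.
  by move=> kb; apply: M_gen => m /ng; apply: leq_trans.
have Md k (f : {linear M k -> L0}) x : (k <= b.+2)%N -> f (res_d M k x) = 0.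
  by move=> kb; apply: (to_L0_d piP qP M_min (erefl _) gen).
have bb : (b <= b.+2)%N by apply: leqW.
have [N [u [y [sg db]]]] := dual_basis_exists piP L_fd qP M_min (erefl _) gen bb.
have [phi [psi [s [phic phiE sE]]]] := comparison_homotopy P M.
have h_ex i : exists h : forall j, {linear M (j + b)%N -> M j},
    chain_map (fun j => res_d M (j + b)) h /\ forall x, res_aug M (h 0%N x) = y i x.
  have [] := @chain_map_exists K L L0 (fun j => M (j + b)%N)
      (fun j => res_d M (j + b)) _ _ M (y i).
  - by move=> j; apply: res_projective.
  - by move=> j x; apply: bd_d0.
  - by move=> x; apply: (Md b).
  by move=> h hc hE; exists h.
pose h i := sval (cid (h_ex i)).
have hc i : chain_map (fun j => res_d M (j + b)) (h i) by case: (svalP (cid (h_ex i))).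
have hE i x : res_aug M (h i 0%N x) = y i x by case: (svalP (cid (h_ex i))).
(* The factorization takes place on the minimal resolution [M], so c is first pulled back along
   psi. *)
have [x xE] := sum_of_products I_adm piP L_fd qP M_min (erefl _) gen (isT : (1 < b.+2)%N)
  (erefl _) (mul1n D : delta D A 2 = D) (leqnn b.+2) (delta_add2 D A b2) db
  hE (fun i => hc i 0%N) (fun i => hc i 1%N) (c \o psi b.+2).
have xd i p : (x i \o phi 2) (res_d P 2 p) = 0 by rewrite /= -phic (Md 2%N).
have yd i p : (y i \o phi b) (res_d P b p) = 0 by rewrite /= -phic (Md b).
have l_ex i := single_mul (xd i) (yd i).
pose l i := sval (cid (l_ex i)).
have lP i := svalP (cid (l_ex i)).
pose F i : {linear P b.+2 -> L0} := x i \o phi 2 \o l i 2.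
have Fd i p : F i (res_d P b.+2 p) = 0.
  by have [lc _ _] := lP i; rewrite /= -[l i 2 _]lc -phic (Md 2%N).
(* Both h_i o phi and phi o l_i lift y_i o phi to [M], hence are homotopic. *)
have t_ex i : exists t : forall j, {linear P (j + b)%N -> M j.+1}, forall j p,
    h i j.+1 (phi (j.+1 + b)%N p) - phi j.+1 (l i j.+1 p) =
    res_d M j.+1 (t j.+1 p) + t j (res_d P (j + b) p).
  have [lc laug _] := lP i.
  apply: (@chain_homotopy K L L0 (fun j => P (j + b)%N) (fun j => res_d P (j + b))
    _ _ M (fun j => h i j \o phi (j + b)%N) (fun j => phi j \o l i j)).
  - by move=> j; apply: res_projective.
  - by move=> j p; apply: bd_d0.
  - by move=> j p /=; rewrite hc -phic.
  - by move=> j p /=; rewrite phic lc.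
  by move=> p; rewrite /= hE phiE laug.
pose t i := sval (cid (t_ex i)).
have tE i := svalP (cid (t_ex i)).
(* The total correction: the first term pays for replacing the identity by psi o phi, the others for
   replacing h_i o phi by phi o l_i. *)
have gL : linear (fun p : P b.+1 => c (s b.+1 p) + \sum_i x i (t i 1%N p)).
  move=> a p p'; rewrite !linearP scalerDr addrACA scaler_sumr -big_split.
  by congr (_ + _); apply: eq_bigr => i _; rewrite !linearP.
pose g := mk_linear gL.
have cE p : c p = \sum_i F i p + g (res_d P b.+1 p).
  rewrite -[p in LHS](subrK (psi b.+2 (phi b.+2 p))) sE !linearD cd add0r.
  rewrite -[c (psi _ _)]/((c \o psi b.+2) (phi b.+2 p)) xE /= [RHS]addrCA.
  congr (_ + _); rewrite -big_split; apply: eq_bigr => i _ /=.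
  rewrite -[h i 2 _](subrK (phi 2 (l i 2 p))) tE !linearD (Md 2%N) // add0r.
  by rewrite addrC.
(* Subtracting the coboundary of g gives a cocycle in the class of c that equals the sum of the
   [F i] on the nose. *)
have c0d p : (c \- (g \o res_d P b.+1)) (res_d P b.+2 p) = 0.
  by rewrite -[LHS]/(c _ - g _) cd bd_d0 linear0 subr0.
have -> : ext_class (single cd) = ext_class (single c0d).
  apply/ext_classP/(@single_cohom _ _ _ _ b.+1 _ cd _ c0d g) => p.
  by rewrite -[LHS]/(c p - (c p - g (res_d P b.+1 p))) subKr.
apply: (subalgebra_single_sum SP (F := F)) => [i Fd'||p].
- have [_ _ ->] := lP i; last by [].
  case: SP => _ _ SM; apply: SM; last exact: (IH b (leqnSn _)).
  by apply: SG; exists 2%N => //; exists (single (xd i)) => // m p; apply: single_0.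
- by move=> i p; apply: Fd.
by rewrite -[LHS]/(c p - g (res_d P b.+1 p)) cE addrK.
Qed.
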